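(* Let $n\ge 1$ and let $\mathbb{H}$ be the real quaternions. An element of the group $\mathrm{PSL}(n,\mathbb{H})=\mathrm{SL}(n,\mathbb{H})/\{\pm \mathrm{I}_n\}$ is reversible in $\mathrm{PSL}(n,\mathbb{H})$ if and only if it is strongly reversible in $\mathrm{PSL}(n,\mathbb{H})$.
   Context: Determinant: for $A\in \mathrm{M}(n,\mathbb{H})$ write $A=A_1+A_2\mathbf{j}$ with $A_1,A_2\in \mathrm{M}(n,\mathbb{C})$, and set $\det(A):=\det\begin{pmatrix} A_1 & A_2\\ -\overline{A_2} & \overline{A_1}\end{pmatrix}$ (the usual determinant of a $2n\times 2n$ complex matrix). $\mathrm{SL}(n,\mathbb{H})=\{g\in \mathrm{M}(n,\mathbb{H}) : \det(g)=1\}$. In a group $G$ with identity $e$: an involution is an element $\iota$ with $\iota^2=e$ (so $e$ is allowed); $g\in G$ is reversible if $hgh^{-1}=g^{-1}$ for some $h\in G$; $g$ is strongly reversible if $hgh^{-1}=g^{-1}$ for some involution $h\in G$ (equivalently, $g$ is a product of two involutions in $G$). *)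

(* Defs.v *)
From HB Require Import structures.
From mathcomp Require Import all_boot all_order all_algebra.
From mathcomp Require Import reals.
From mathcomp Require Import complex ring.

Set Implicit Arguments.
Unset Strict Implicit.
Unset Printing Implicit Defensive.

Import GRing.Theory Num.Theory.

Local Open Scope ring_scope.
Local Open Scope quotient_scope.

Section Reversibility.

Local Open Scope group_scope.

Variable G : groupType.

Definition involution (x : G) : Prop := x ^+ 2 = 1.

Definition reversible (g : G) : Prop :=
  exists h : G, h * g * h^-1 = g^-1.

Definition strongly_reversible (g : G) : Prop :=
  exists h : G, involution h /\ h * g * h^-1 = g^-1.

End Reversibility.

(* [Quat z w] is the quaternion z + w j, with z and w complex. *)
Record quat (R : Type) : Type := Quat { qfst : R[i]; qsnd : R[i] }.

Section QuatChoice.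

Definition pair_of_quat (R : Type) (q : quat R) : R[i] * R[i] :=
  (qfst q, qsnd q).

Definition quat_of_pair (R : Type) (p : R[i] * R[i]) : quat R :=
  Quat p.1 p.2.

Lemma pair_of_quatK (R : Type) :
  cancel (@pair_of_quat R) (@quat_of_pair R).
Proof. by case. Qed.

End QuatChoice.

HB.instance Definition _ (R : eqType) :=
  Equality.copy (quat R) (can_type (@pair_of_quatK R)).
HB.instance Definition _ (R : choiceType) :=
  Choice.copy (quat R) (can_type (@pair_of_quatK R)).

Section QuatRing.

Variable R : rcfType.
Local Notation H := (quat R).

Definition addq (p q : H) : H :=
  Quat (qfst p + qfst q) (qsnd p + qsnd q).
Definition oppq (p : H) : H := Quat (- qfst p) (- qsnd p).

Lemma addqA : associative addq.
Proof. by move=> x y z; rewrite /addq /= !addrA. Qed.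
Lemma addqC : commutative addq.
Proof. by move=> x y; rewrite /addq addrC [qsnd x + _]addrC. Qed.
Lemma add0q : left_id (Quat 0 0) addq.
Proof. by case=> a b; rewrite /addq /= !add0r. Qed.
Lemma addNq : left_inverse (Quat 0 0) oppq addq.
Proof. by case=> a b; rewrite /addq /= !addNr. Qed.

HB.instance Definition _ := GRing.isZmodule.Build H addqA addqC add0q addNq.

(* Obtained by expanding (z + w j) (z' + w' j) with j z = z^* j, j^2 = -1. *)
Definition mulq (p q : H) : H :=
  Quat (qfst p * qfst q - qsnd p * (qsnd q)^*)
       (qfst p * qsnd q + qsnd p * (qfst q)^*).

Lemma mulqA : associative mulq.
Proof.
move=> x y z; rewrite /mulq /= !(rmorphB, rmorphD, rmorphM) /= !conjCK.
by congr Quat; ring.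
Qed.

Lemma mul1q : left_id (Quat 1 0) mulq.
Proof. by case=> a b; rewrite /mulq /= !mul1r !mul0r subr0 addr0. Qed.
Lemma mulq1 : right_id (Quat 1 0) mulq.
Proof.
by case=> a b; rewrite /mulq /= rmorph0 rmorph1 !mulr1 !mulr0 subr0 add0r.
Qed.
Lemma mulqDl : left_distributive mulq addq.
Proof.
move=> x y z; rewrite /mulq /addq /=; congr Quat.
  by rewrite !mulrDl opprD addrACA.
by rewrite !mulrDl addrACA.
Qed.
Lemma mulqDr : right_distributive mulq addq.
Proof.
move=> x y z; rewrite /mulq /addq /=; congr Quat.
  by rewrite rmorphD !mulrDr opprD addrACA.
by rewrite rmorphD !mulrDr addrACA.
Qed.
Lemma oneq_neq0 : Quat 1 0 != 0 :> H.
Proof. by apply/eqP => -[] /eqP; rewrite (oner_eq0 R). Qed.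

HB.instance Definition _ := GRing.Zmodule_isNzRing.Build H
  mulqA mul1q mulq1 mulqDl mulqDr oneq_neq0.

Lemma qfst_is_additive : additive (@qfst R). Proof. by []. Qed.
Lemma qsnd_is_additive : additive (@qsnd R). Proof. by []. Qed.
HB.instance Definition _ :=
  GRing.isAdditive.Build H R[i] (@qfst R) qfst_is_additive.
HB.instance Definition _ :=
  GRing.isAdditive.Build H R[i] (@qsnd R) qsnd_is_additive.

Definition qI : H := Quat 'i 0.
Definition qJ : H := Quat 0 1.
Definition qK : H := Quat 0 'i.

Lemma qI_sqr : qI * qI = -1.
Proof.
by congr Quat; rewrite /= ?rmorph0 ?mul0r ?mulr0 ?subr0 ?addr0 ?oppr0 //
  -expr2 sqrCi.
Qed.
Lemma qJ_sqr : qJ * qJ = -1.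
Proof.
by congr Quat; rewrite /= ?rmorph0 ?rmorph1 ?mul0r ?mulr0 ?mulr1 ?sub0r
  ?addr0 ?oppr0.
Qed.
Lemma qIJ : qI * qJ = qK.
Proof.
by congr Quat; rewrite /= ?rmorph0 ?rmorph1 ?mul0r ?mulr0 ?mulr1 ?subr0 ?addr0.
Qed.
Lemma qJI : qJ * qI = - qK.
Proof.
by congr Quat; rewrite /= ?rmorph0 ?conjCi ?mul0r ?mulr0 ?mul1r ?subr0 ?add0r
  ?oppr0.
Qed.

Lemma qJ_conj (z : R[i]) : qJ * Quat z 0 = Quat z^* 0 * qJ.
Proof.
by congr Quat; rewrite /= ?rmorph0 ?rmorph1 ?mul0r ?mulr0 ?mul1r ?mulr1
  ?subr0 ?addr0 ?add0r.
Qed.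
Lemma quat_split (z w : R[i]) : Quat z w = Quat z 0 + Quat w 0 * qJ.
Proof.
by congr Quat; rewrite /= ?rmorph0 ?rmorph1 ?mul0r ?mulr0 ?mul1r ?mulr1
  ?subr0 ?addr0 ?add0r.
Qed.

End QuatRing.

Section SpecialLinear.

Variables (R : rcfType) (n : nat).
Local Notation H := (quat R).
Local Notation C := R[i].

Implicit Types A B : 'M[H]_n.

Local Notation conjmx := (map_mx (Num.conj : C -> C)).

Definition cpart1 A : 'M[C]_n := map_mx (@qfst R) A.
Definition cpart2 A : 'M[C]_n := map_mx (@qsnd R) A.

Definition complexmx A : 'M[C]_(n + n) :=
  block_mx (cpart1 A) (cpart2 A) (- conjmx (cpart2 A)) (conjmx (cpart1 A)).

Definition qdet A : C := \det (complexmx A).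

Lemma cpart1M A B :
  cpart1 (A *m B) = cpart1 A *m cpart1 B - cpart2 A *m conjmx (cpart2 B).
Proof.
apply/matrixP=> i j; rewrite !mxE raddf_sum /= -sumrB.
by apply: eq_bigr => k _; rewrite !mxE.
Qed.

Lemma cpart2M A B :
  cpart2 (A *m B) = cpart1 A *m cpart2 B + cpart2 A *m conjmx (cpart1 B).
Proof.
apply/matrixP=> i j; rewrite !mxE raddf_sum /= -big_split.
by apply: eq_bigr => k _; rewrite !mxE.
Qed.

Lemma conjmxK : involutive (conjmx : 'M[C]_n -> 'M[C]_n).
Proof. by move=> A; apply/matrixP=> i j; rewrite !mxE conjCK. Qed.

Lemma complexmxM A B : complexmx (A *m B) = complexmx A *m complexmx B.
Proof.
rewrite /complexmx mulmx_block cpart1M cpart2M.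
rewrite map_mxB map_mxD !map_mxM /= !conjmxK.
by rewrite !mulmxN !mulNmx [in LHS]opprD [X in block_mx _ _ X _]addrC
  [X in block_mx _ _ _ X]addrC.
Qed.

Lemma complexmx1 : complexmx 1%:M = 1%:M.
Proof.
have e1 : cpart1 1%:M = 1%:M.
  by apply/matrixP=> i j; rewrite !mxE raddfMn.
have e2 : cpart2 1%:M = 0.
  by apply/matrixP=> i j; rewrite !mxE raddfMn /= mul0rn.
by rewrite /complexmx e1 e2 map_mx1 raddf0 oppr0 -scalar_mx_block.
Qed.

Lemma complexmx_inj : injective complexmx.
Proof.
move=> A B /eq_block_mx[/matrixP e1 /matrixP e2 _ _].
apply/matrixP=> i j; move: (e1 i j) (e2 i j); rewrite !mxE.
by case: (A i j) (B i j) => [? ?] [? ?] /= -> ->.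
Qed.

Lemma complexmxN A : complexmx (- A) = - complexmx A.
Proof.
rewrite /complexmx opp_block_mx.
have -> : cpart1 (- A) = - cpart1 A by apply/matrixP=> i j; rewrite !mxE.
have -> : cpart2 (- A) = - cpart2 A by apply/matrixP=> i j; rewrite !mxE.
by rewrite !map_mxN.
Qed.

Lemma qdetM A B : qdet (A *m B) = qdet A * qdet B.
Proof. by rewrite /qdet complexmxM det_mulmx. Qed.

Lemma qdet1 : qdet 1%:M = 1.
Proof. by rewrite /qdet complexmx1 det1. Qed.

Lemma qdetN A : qdet (- A) = qdet A.
Proof.
have e1 : (-1) ^+ (n + n) = 1 :> C by rewrite -signr_odd addnn odd_double.
by rewrite /qdet complexmxN -scaleN1r detZ e1 mul1r.
Qed.

(* Read off from the two upper blocks of the inverse complex matrix. *)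
Definition invqmx A : 'M[H]_n :=
  let X := invmx (complexmx A) in
  \matrix_(i, j) Quat (ulsubmx X i j) (ursubmx X i j).

Lemma complexmx_inv A :
  complexmx A \in unitmx -> complexmx (invqmx A) = invmx (complexmx A).
Proof.
move=> uA; set X := invmx _.
pose S : 'M[C]_(n + n) := block_mx 0 1%:M (- 1%:M) 0.
have SS : S *m S = - 1%:M.
  rewrite /S mulmx_block !mulmx0 !mul0mx !mulmx1 !mul1mx !addr0 !add0r.
  by rewrite scalar_mx_block opp_block_mx oppr0.
have key Y : map_mx (Num.conj : C -> C) Y *m S = S *m Y <->
    dlsubmx Y = - conjmx (ursubmx Y) /\ drsubmx Y = conjmx (ulsubmx Y).
  rewrite -{1 2}[Y]submxK map_block_mx /S !mulmx_block.
  rewrite !mulmx0 !mul0mx !mulmxN !mulNmx !mulmx1 !mul1mx !addr0 !add0r.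
  split=> [/eq_block_mx[<- <- _ _] //|[-> ->]].
  congr block_mx; last by rewrite map_mxN conjmxK.
  by rewrite conjmxK.
have /key [e1 e2] : map_mx (Num.conj : C -> C) X *m S = S *m X.
  have eA : map_mx (Num.conj : C -> C) (complexmx A) *m S = S *m complexmx A.
    apply/key.
    by rewrite /complexmx block_mxKul block_mxKur block_mxKdl block_mxKdr.
  have cX : map_mx (Num.conj : C -> C) X *m map_mx (Num.conj : C -> C) (complexmx A) = 1%:M.
    by rewrite -map_mxM mulVmx // map_mx1.
  rewrite -[LHS]mulmx1 -(mulmxV uA) -/X [LHS]mulmxA -[X in X *m _]mulmxA -eA.
  by rewrite [X in X *m _]mulmxA cX mul1mx.
rewrite -[RHS]submxK /complexmx e1 e2.
have -> : cpart1 (invqmx A) = ulsubmx X.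
  by apply/matrixP=> i j; rewrite !mxE.
have -> // : cpart2 (invqmx A) = ursubmx X.
by apply/matrixP=> i j; rewrite !mxE.
Qed.

Lemma complexmx_unit A : qdet A = 1 -> complexmx A \in unitmx.
Proof. by rewrite unitmxE -/(qdet A) => ->; rewrite unitr1. Qed.

Record SL : Type := MkSL { slval :> 'M[H]_n; _ : qdet slval == 1 }.

HB.instance Definition _ := [isSub for slval].
HB.instance Definition _ := [Choice of SL by <:].

Lemma qdet_sl (g : SL) : qdet g = 1.
Proof. by case: g => g /= /eqP. Qed.

Lemma mulsl_subproof (g h : SL) : qdet (g *m h) == 1.
Proof. by rewrite qdetM !qdet_sl mulr1. Qed.
Lemma onesl_subproof : qdet 1%:M == 1.
Proof. by rewrite qdet1. Qed.
Lemma invsl_subproof (g : SL) : qdet (invqmx g) == 1.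
Proof.
have g1 := qdet_sl g.
by rewrite /qdet complexmx_inv ?complexmx_unit // det_inv -/(qdet g) g1 invr1.
Qed.
Lemma oppsl_subproof (g : SL) : qdet (- slval g) == 1.
Proof. by rewrite qdetN qdet_sl. Qed.

Definition mulsl (g h : SL) : SL := MkSL (mulsl_subproof g h).
Definition onesl : SL := MkSL onesl_subproof.
Definition invsl (g : SL) : SL := MkSL (invsl_subproof g).
Definition oppsl (g : SL) : SL := MkSL (oppsl_subproof g).

Lemma mulslA : associative mulsl.
Proof. by move=> x y z; apply: val_inj; rewrite /= mulmxA. Qed.
Lemma mul1sl : left_id onesl mulsl.
Proof. by move=> x; apply: val_inj; rewrite /= mul1mx. Qed.
Lemma mulsl1 : right_id onesl mulsl.
Proof. by move=> x; apply: val_inj; rewrite /= mulmx1. Qed.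
Lemma mulVsl : left_inverse onesl invsl mulsl.
Proof.
move=> x; apply/val_inj/complexmx_inj; have x1 := qdet_sl x.
by rewrite /= complexmxM complexmx1 complexmx_inv ?mulVmx ?complexmx_unit.
Qed.
Lemma mulslV : right_inverse onesl invsl mulsl.
Proof.
move=> x; apply/val_inj/complexmx_inj; have x1 := qdet_sl x.
by rewrite /= complexmxM complexmx1 complexmx_inv ?mulmxV ?complexmx_unit.
Qed.

HB.instance Definition _ :=
  isGroup.Build SL mulslA mul1sl mulsl1 mulVsl mulslV.

End SpecialLinear.

Section ProjectiveSpecialLinear.

Variables (R : rcfType) (n : nat).
Local Notation SL := (SL R n).

Local Open Scope group_scope.

Definition negI : SL := oppsl 1.

Definition pm1 : seq SL := [:: 1; negI].

Lemma mulNsl (g : SL) : negI * g = oppsl g.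
Proof. by apply: val_inj; rewrite /= mulNmx mul1mx. Qed.
Lemma mulslN (g : SL) : g * negI = oppsl g.
Proof. by apply: val_inj; rewrite /= mulmxN mulmx1. Qed.
Lemma negI_sqr : negI * negI = 1.
Proof. by apply: val_inj; rewrite mulNsl /= opprK. Qed.
Lemma negIC (g : SL) : negI * g = g * negI.
Proof. by rewrite mulNsl mulslN. Qed.

Lemma pm1_1 : 1 \in pm1. Proof. by rewrite inE eqxx. Qed.
Lemma pm1M x y : x \in pm1 -> y \in pm1 -> x * y \in pm1.
Proof.
rewrite !inE => /orP[] /eqP -> /orP[] /eqP ->;
  by rewrite ?mul1g ?mulg1 ?negI_sqr eqxx ?orbT.
Qed.
Lemma pm1V x : x \in pm1 -> x^-1 \in pm1.
Proof.
have nV : negI^-1 = negI by apply/(mulgI negI); rewrite mulgV negI_sqr.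
by rewrite !inE => /orP[] /eqP ->; rewrite ?invg1 ?nV eqxx ?orbT.
Qed.
Lemma pm1C x y : x \in pm1 -> x * y = y * x.
Proof.
by rewrite !inE => /orP[] /eqP ->; rewrite ?mul1g ?mulg1 ?negIC.
Qed.

Definition psl_eqv (g h : SL) : bool := g^-1 * h \in pm1.

Lemma psl_eqv_refl : reflexive psl_eqv.
Proof. by move=> x; rewrite /psl_eqv mulVg pm1_1. Qed.
Lemma psl_eqv_imp x y : psl_eqv x y -> psl_eqv y x.
Proof. by move=> /pm1V; rewrite invgM invgK. Qed.
Lemma psl_eqv_sym : symmetric psl_eqv.
Proof. by move=> x y; apply/idP/idP; apply: psl_eqv_imp. Qed.
Lemma psl_eqv_trans : transitive psl_eqv.
Proof.
by move=> y x z xy yz; have := pm1M xy yz; rewrite -mulgA mulVKg.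
Qed.

Canonical psl_equiv :=
  EquivRel psl_eqv psl_eqv_refl psl_eqv_sym psl_eqv_trans.

Definition PSL : Type := {eq_quot psl_equiv}.

HB.instance Definition _ := Choice.on PSL.
HB.instance Definition _ := EqQuotient.on PSL.

Definition pslpi (g : SL) : PSL := \pi_PSL g.

Definition onepsl : PSL := pslpi 1.
Definition mulpsl (x y : PSL) : PSL := pslpi (repr x * repr y).
Definition invpsl (x : PSL) : PSL := pslpi (repr x)^-1.

Lemma pslpiP g h : reflect (pslpi g = pslpi h) (g^-1 * h \in pm1).
Proof.
rewrite -[_ \in _]/(psl_equiv g h); exact: (@eqquotP _ _ PSL g h).
Qed.

Lemma pslpi_repr x : pslpi (repr x) = x.
Proof. exact: reprK. Qed.

Lemma repr_pslpi g : exists2 z, z \in pm1 & repr (pslpi g) = g * z.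
Proof.
exists (g^-1 * repr (pslpi g)); last by rewrite mulVKg.
by apply/pslpiP; rewrite pslpi_repr.
Qed.

Lemma pslpiM g h : mulpsl (pslpi g) (pslpi h) = pslpi (g * h).
Proof.
have [z zP ez] := repr_pslpi g; have [w wP ew] := repr_pslpi h.
apply/esym/pslpiP; rewrite ez ew -(mulgA g) (mulgA z) (pm1C _ zP).
by rewrite !mulgA invgM -!mulgA mulKg mulKg pm1M.
Qed.

Lemma pslpiV g : invpsl (pslpi g) = pslpi g^-1.
Proof.
have [z zP ez] := repr_pslpi g.
apply/esym/pslpiP; rewrite ez invgK invgM (pm1C _ (pm1V zP)).
by rewrite mulVKg pm1V.
Qed.

Lemma mulpslA : associative mulpsl.
Proof.
move=> x y z; rewrite -(pslpi_repr x) -(pslpi_repr y) -(pslpi_repr z).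
by rewrite !pslpiM mulgA.
Qed.
Lemma mul1psl : left_id onepsl mulpsl.
Proof. by move=> x; rewrite -(pslpi_repr x) pslpiM mul1g. Qed.
Lemma mulpsl1 : right_id onepsl mulpsl.
Proof. by move=> x; rewrite -(pslpi_repr x) pslpiM mulg1. Qed.
Lemma mulVpsl : left_inverse onepsl invpsl mulpsl.
Proof. by move=> x; rewrite -(pslpi_repr x) pslpiV pslpiM mulVg. Qed.
Lemma mulpslV : right_inverse onepsl invpsl mulpsl.
Proof. by move=> x; rewrite -(pslpi_repr x) pslpiV pslpiM mulgV. Qed.

HB.instance Definition _ :=
  isGroup.Build PSL mulpslA mul1psl mulpsl1 mulVpsl mulpslV.

Lemma pslpi_morph : {morph pslpi : g h / g * h}.
Proof. by move=> g h; rewrite -pslpiM. Qed.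

Lemma pslpi_surj (x : PSL) : exists g, x = pslpi g.
Proof. by exists (repr x); rewrite pslpi_repr. Qed.

Lemma pslpi_eq (g h : SL) :
  pslpi g = pslpi h <-> slval h = slval g \/ slval h = (- slval g)%R.
Proof.
have [gh0|gh0] := pslpiP g h; split=> //.
  move=> _; move: gh0 => /pslpiP; rewrite !inE => /orP[] /eqP e.
    by left; rewrite -(mulVKg g h) e mulg1.
  by right; rewrite -(mulVKg g h) e mulslN.
case=> e; case: gh0; apply/pslpiP; rewrite !inE.
  by rewrite (val_inj e) mulVg eqxx.
have -> : h = g * negI by apply: val_inj; rewrite mulslN.
by rewrite mulKg eqxx orbT.
Qed.

End ProjectiveSpecialLinear.

(* Main.v *)
From HB Require Import structures.
Require Import Defs.
From mathcomp Require Import all_boot all_order all_algebra.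
From mathcomp Require Import reals complex ring.

Set Implicit Arguments. Unset Strict Implicit. Unset Printing Implicit Defensive.

Import Order.TTheory GRing.Theory Num.Theory.
Local Open Scope ring_scope.
Local Open Scope complex_scope.

(** Idea. It suffices to find, for matrices with [h g = e g^-1 h] and
    [e = 1] or [e = -1], a quaternionic [Y] with [Y^2 = -1] and
    [Y g = e g^-1 Y]: then [Y = ((1 + Y) / sqrt 2)^2] has determinant 1, and
    [Y] is an involution of PSL. Put [u = g + e g^-1], [w = g - e g^-1]; then
    [w^2 = u^2 - 4 e], [h] commutes with [u] and anticommutes with [w], and
    [Y] has to do the same. Primary decomposition of [h^2] over the reals
    replaces [h] by [h p(h^2)], whose square is [-1], as wanted, or [1].
    In the second case call it [k] and decompose along [u]:
    - on a non-real eigenvalue, [Y = k c] with [c] a polynomial in [u],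
      [c^2 = -1];
    - on a real eigenvalue [r] with [r^2 > 4 e], [Y = k w v] with [v] a
      polynomial in [u], [v^-2 = u^2 - 4 e];
    - on a real eigenvalue with [r^2 <= 4 e], [Y = k c] where [c] is a complex
      structure commuting with [k], [u] and [w]. It exists because a nilpotent
      quaternionic matrix, possibly anticommuting with an involution, commutes
      with a complex structure; this uses only that the matrix ring is von
      Neumann regular and that its corners contain square roots of [-1]. *)

(** * Primary decomposition and square roots modulo real polynomials *)

Section RealPoly.

Variable R : rcfType.
Implicit Types (p q d m y : {poly R}) (P : {poly R} -> Prop).

(** For [b != 0], the minimal polynomial over the reals of the complex number [a + i b]. *)
Definition quadp (a b : R) : {poly R} := ('X - a%:P) ^+ 2 + (b ^+ 2)%:P.

Lemma poly_strip d m : irreducible_poly d -> m != 0 ->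
  exists k m', m = d ^+ k * m' /\ coprimep d m'.
Proof.
move=> irr_d; have [n] := ubnP (size m); elim: n m => // n IHn m szm m0.
have [/dvdpP[m1 em]|ndm] := boolP (d %| m); last first.
  by exists 0%N, m; rewrite expr0 mul1r irreducible_poly_coprime.
have m10 : m1 != 0 by apply: contraNneq m0 => m10; rewrite em m10 mul0r.
have d0 := irredp_neq0 irr_d.
have [k [m' [em1 cd]]] : exists k m', m1 = d ^+ k * m' /\ coprimep d m'.
  apply: IHn => //; move: szm; rewrite em size_mul // ltnS.
  case: irr_d; case: (size d) => [|[|s]] // _ _.
  by rewrite addnS /= addnS; apply/leq_ltn_trans/leq_addr.
by exists k.+1, m'; rewrite em em1 exprS mulrC mulrA.
Qed.

Lemma quadp_gt0 a b x : b != 0 -> 0 < (quadp a b).[x].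
Proof.
move=> b0; rewrite !hornerE ltr_wpDl ?sqr_ge0 //.
by rewrite lt_neqAle sqr_ge0 eq_sym expf_neq0.
Qed.

Lemma quadp_irr a b : b != 0 -> irreducible_poly (quadp a b).
Proof.
move=> b0; apply: cubic_irreducible.
  rewrite size_polyDl size_exp_XsubC //.
  by rewrite (leq_ltn_trans (size_polyC_leq1 _)).
by move=> x; rewrite /root gt_eqF // quadp_gt0.
Qed.

(** Take a complex root [a + i b] of [m]. If [b] is nonzero and [quadp a b] does not divide [m],
    irreducibility makes the two coprime, and a Bezout identity evaluated at the root reads
    [0 = 1]. *)
Lemma irr_factor m : (1 < size m)%N ->
  (exists r, 'X - r%:P %| m) \/ (exists a b, b != 0 /\ quadp a b %| m).
Proof.
move=> szm; pose toC := real_complex R.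
have /closed_rootP[z] : size (map_poly toC m) != 1.
  by rewrite size_map_poly; case: (size m) szm => [|[]].
case: z => a b rz; have [b0|b0] := eqVneq b 0.
  left; exists a; rewrite dvdp_XsubCl; move: rz; rewrite b0.
  by rewrite -[a +i* 0]/(toC a) fmorph_root.
right; exists a, b; split=> //; apply: contraLR rz => nd.
have := irreducible_poly_coprime m (quadp_irr a b0); rewrite nd.
case/Bezout_eq1_coprimepP=> -[s t] /= e1; apply/rootP => rz.
move/(congr1 (fun p => (map_poly toC p).[a +i* b])): e1.
rewrite rmorphD !rmorphM /= !hornerE rz mulr0 addr0 rmorph1 hornerC.
rewrite /quadp rmorphD rmorphXn rmorphB /= !map_polyC map_polyX /= !hornerE /=.
have -> : (a +i* b - toC a) ^+ 2 + toC (b ^+ 2) = 0.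
  rewrite expr2; apply/eqP; rewrite eq_complex /=; apply/andP.
  by split; apply/eqP; ring.
by rewrite mulr0 => /esym/eqP; rewrite oner_eq0.
Qed.

(** The induction behind the primary decompositions: strip from [m] the full power of an irreducible
    factor; the cofactor is coprime to it and has smaller degree. *)
Lemma real_poly_ind P :
    (forall c, c != 0 -> P c%:P) ->
    (forall r k, P (('X - r%:P) ^+ k)) ->
    (forall a b k, b != 0 -> P (quadp a b ^+ k)) ->
    (forall m1 m2, coprimep m1 m2 -> P m1 -> P m2 -> P (m1 * m2)) ->
  forall m, m != 0 -> P m.
Proof.
move=> Pc PX Pq PM m; have [n] := ubnP (size m); elim: n m => // n IHn m szm m0.
have [szm1|szm1] := leqP (size m) 1.
  move: m0; rewrite (size1_polyC szm1) polyC_eq0; exact: Pc.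
have [d [irr_d dm Pd]] :
    exists d, [/\ irreducible_poly d, d %| m & forall k, P (d ^+ k)].
  case: (irr_factor szm1) => [[r rm]|[a [b [b0 qm]]]].
    by exists ('X - r%:P); split=> //; apply: irredp_XsubC.
  by exists (quadp a b); split=> // [|k]; [apply: quadp_irr|apply: Pq].
have [[|k] [m' [em cd]]] := poly_strip irr_d m0.
  move: cd; rewrite expr0 mul1r in em; rewrite -em.
  by rewrite irreducible_poly_coprime // dm.
have m'0 : m' != 0 by apply: contraNneq m0 => m'0; rewrite em m'0 mulr0.
rewrite em; apply: PM => //; first exact: coprimep_expl.
have d0 := irredp_neq0 irr_d.
apply: IHn => //; move: szm; rewrite em mulrC size_mul ?expf_neq0 //.
have : (1 < size (d ^+ k.+1))%N.
  case: irr_d => sz_d _; apply: leq_trans sz_d _.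
  by rewrite dvdp_leq ?exprS ?dvdp_mulr // mulf_neq0 ?expf_neq0.
case: (size (d ^+ _)) => [|[|s]] // _; rewrite ltnS !addnS /=.
exact/leq_ltn_trans/leq_addr.
Qed.

(* Newton iteration for [v ^- 2 = q]: the new residue is a multiple of the
   square of the old one. *)
Lemma hensel_invsqrt d q v0 k : d %| q * v0 ^+ 2 - 1 ->
  exists v, d ^+ k %| q * v ^+ 2 - 1.
Proof.
move=> dv0; suff [v dv] : exists v, d ^+ (2 ^ k) %| q * v ^+ 2 - 1.
  exists v; apply: dvdp_trans dv.
  exact/dvdp_exp2l/ltnW/ltn_expl.
elim: k => [|k [v /dvdpP[e ev]]]; first by exists v0.
pose h : {poly R} := 2^-1%:P.
have h2 : h * 2 = 1 by rewrite -(polyC_natr R 2) -polyCM mulVf ?pnatr_eq0.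
exists (v * (1 - h * (q * v ^+ 2 - 1))).
have -> : q * (v * (1 - h * (q * v ^+ 2 - 1))) ^+ 2 - 1 =
    (q * v ^+ 2 - 1) ^+ 2 * (h ^+ 2 * (q * v ^+ 2) - 1)
    + (1 - h * 2) * (q * v ^+ 2 - 1) * q * v ^+ 2 by ring.
rewrite h2 subrr !mul0r addr0 ev exprMn -exprM -mulnC -expnS.
by rewrite mulrAC dvdp_mulIr.
Qed.

Lemma invsqrt_mod_linear r q k : 0 < q.[r] ->
  exists v, ('X - r%:P) ^+ k %| q * v ^+ 2 - 1.
Proof.
move=> q0; apply: (@hensel_invsqrt _ _ (Num.sqrt q.[r])^-1%:P).
rewrite dvdp_XsubCl; apply/rootP.
rewrite hornerD hornerN hornerM horner_exp !hornerC exprVn sqr_sqrtr.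
  by rewrite mulfV ?subrr ?gt_eqF.
exact: ltW.
Qed.

(* Modulo [quadp a b] the polynomial [s + t ('X - a)] is the complex number
   [s + i t b]. *)
Lemma invsqrt_mod_quadratic a b s t k : b != 0 -> s +i* (t * b) != 0 ->
  exists v, quadp a b ^+ k %| (s%:P + t%:P * ('X - a%:P)) * v ^+ 2 - 1.
Proof.
move=> b0 z0.
case e: (sqrtc (s +i* (t * b))^-1) => [x y].
(* Modulo [quadp a b], the inverse square root [x + i y] is represented by [x + h ('X - a)]. *)
pose h := y / b; have ey : y = h * b by rewrite mulfVK.
have : (s +i* (t * b)) * (x +i* y) ^+ 2 = 1 by rewrite -e sqr_sqrtc mulfV.
rewrite expr2 => /eqP; rewrite eq_complex /= => /andP[/eqP e1 /eqP e2].
have {}e1 : s * (x ^+ 2 - h ^+ 2 * b ^+ 2) - 2 * t * x * h * b ^+ 2 = 1.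
  by rewrite -[RHS]e1 ey; ring.
have {}e2 : t * (x ^+ 2 - h ^+ 2 * b ^+ 2) + 2 * s * x * h = 0.
  by apply: (mulIf b0); rewrite mul0r -[RHS]e2 ey; ring.
apply: (@hensel_invsqrt _ _ (x%:P + h%:P * ('X - a%:P))).
(* The quotient of the Euclidean division by [quadp a b]; [e1] and [e2] make the remainder zero. *)
apply/dvdpP; exists ((s * h ^+ 2 + 2 * t * x * h)%:P + (t * h ^+ 2)%:P * ('X - a%:P)).
rewrite -[1 in LHS]/(1%:P) -[in LHS]e1.
rewrite -[LHS]subr0 -[0](mul0r ('X - a%:P)) -[0]/(0%:P) -[in LHS]e2 /quadp.
rewrite !(polyCM, polyCB, polyCD, polyC_exp) polyC1; ring.
Qed.

End RealPoly.

(** * Complex structures commuting with a nilpotent element *)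

Section CommutingStructure.

Variables (E : nzRingType) (hf : E).
Hypotheses (hf2 : hf + hf = 1) (hfC : forall x, x * hf = hf * x).
(* The even and odd parts of a [Z/2]-graded subring of [E], not necessarily
   unital. *)
Variables S O : E -> Prop.
Hypothesis SD : forall x y, S x -> S y -> S (x + y).
Hypothesis SN : forall x, S x -> S (- x).
Hypothesis SM : forall x y, S x -> S y -> S (x * y).
Hypothesis Shf : forall x, S x -> S (hf * x).
Hypothesis SO : forall x y, S x -> O y -> O (x * y).
Hypothesis OS : forall x y, O x -> S y -> O (x * y).
Hypothesis OO : forall x y, O x -> O y -> S (x * y).
Hypothesis regS : forall x, S x -> exists2 y, S y & x * y * x = x.
Hypothesis regO : forall x, O x -> exists2 y, O y & x * y * x = x.
Hypothesis idemS : forall f, S f -> f * f = f ->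
  exists c, [/\ S c, f * c = c, c * f = c & c * c = - f].

Lemma mulr_eq (a b c : E) : a * b = c -> forall x, x * a * b = x * c.
Proof. by move=> <- x; rewrite mulrA. Qed.

(* Induction on the nilpotency index: a complex structure [c0] on the image
   [p E] of [N] extends to [p E] + [ker N] and then, through a section [s] of
   [N], to a map [c] commuting with [N] whose square is [- f] up to an element
   [e] of square zero commuting with [c]; finally [c (1 + e / 2)] works. *)
Lemma nilpotent_structure m (f N : E) :
    S f -> f * f = f -> O N -> f * N = N -> N * f = N -> N ^+ m.+1 = 0 ->
  exists c, [/\ S c, f * c = c, c * f = c, c * c = - f & c * N = N * c].
Proof.
elim: m f N => [|m IHm] f N Sf ff ON fN Nf.
  rewrite expr1 => N0; have [c [? ? ? ?]] := idemS Sf ff.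
  by exists c; split=> //; rewrite N0 mulr0 mul0r.
move=> N0; have [s0 Os0 Ns0N] := regO ON.
pose s := f * s0 * f; have Os : O s by apply: OS => //; apply: SO.
have NsN : N * s * N = N by rewrite /s !mulrA Nf (mulr_eq fN).
have fs : f * s = s by rewrite /s !mulrA ff.
have sf : s * f = s by rewrite /s (mulr_eq ff).
(* [p] is an idempotent onto the image of [N]; in its corner, [N * p] satisfies the nilpotency bound
   lowered by one. *)
have [p ep] : exists p, p = N * s by exists (N * s).
have Sp : S p by rewrite ep; apply: OO.
have pN : p * N = N by rewrite ep.
have pp : p * p = p by rewrite {2}ep mulrA pN.
have fp : f * p = p by rewrite ep mulrA fN.
have pf : p * f = p by rewrite ep (mulr_eq sf).
clearbody s.
have [||||c0 [Sc0 pc0 c0p c0c0 c0N]] := IHm p (N * p) Sp pp.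
- exact: OS.
- by rewrite mulrA pN.
- by rewrite (mulr_eq pp).
- suff -> j : (N * p) ^+ j.+1 = N ^+ j.+1 * p.
    by rewrite ep mulrA -exprSr N0 mul0r.
  elim: j => [|j IHj]; first by rewrite !expr1.
  by rewrite exprS IHj !(exprS N) !mulrA (mulr_eq pN).
have {}c0N : N * c0 = c0 * N * p by rewrite -mulrA c0N (mulr_eq pc0).
(* [q] projects onto the kernel of [N]. *)
have [q eq] : exists q, q = f - s * N by exists (f - s * N).
have Sq : S q by rewrite eq; apply/SD/SN/OO.
have fq : f * q = q by rewrite eq mulrBr ff mulrA fs.
have Nq : N * q = 0 by rewrite eq mulrBr Nf mulrA NsN subrr.
have [x ex] : exists x, x = (f - p) * q by exists ((f - p) * q).
have Sfp : S (f - p) by apply/SD/SN.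
have Sx : S x by rewrite ex; apply: SM.
have [y0 Sy0 xy0x] := regS Sx.
(* This change of generalised inverse also gives [y * x * y = y], which makes [k] below
   idempotent. *)
pose y := y0 * x * y0.
have Sy : S y by do 2!apply: SM => //.
have xyx : x * y * x = x by rewrite /y !mulrA xy0x xy0x.
have yxy : y * x * y = y.
  by rewrite /y -!mulrA; congr (_ * _); rewrite !mulrA xy0x xy0x.
clearbody y; clear y0 Sy0 xy0x.
(* The image of [k] lies in the kernel of [N], meets the image of [N] in zero, and spans with it the
   sum of image and kernel. *)
have [k ek] : exists k, k = q * y * (f - p) by exists (q * y * (f - p)).
have Sk : S k by rewrite ek; apply: SM => //; apply: SM.
have kk : k * k = k.
  rewrite ek !mulrA -[q * y * (f - p) * q]mulrA -ex -[q * y * x]mulrA.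
  by rewrite -[q * (y * x) * y]mulrA yxy.
have Nk : N * k = 0 by rewrite ek !mulrA Nq !mul0r.
have kp : k * p = 0 by rewrite ek -!mulrA mulrBl fp pp subrr !mulr0.
have fk : f * k = k by rewrite ek !mulrA fq.
have kf : k * f = k by rewrite ek -!mulrA mulrBl ff pf.
have kN : k * N = 0 by rewrite -pN mulrA kp mul0r.
have fpkq : (f - p) * k * q = x.
  by rewrite ek !mulrA -ex -mulrA -ex xyx.
(* In [f = pi + k + w] the first two idempotents cover the image and the kernel of [N], so [w]
   annihilates both. *)
have [pi epi] : exists z, z = p - p * k by exists (p - p * k).
have [w ew] : exists w, w = f - pi - k by exists (f - pi - k).
have piN : pi * N = N by rewrite epi mulrBl pN (mulr_eq kN) mulr0 subr0.
have wN : w * N = 0 by rewrite ew !mulrBl fN piN kN subrr subr0.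
have wq : w * q = 0.
  have := fpkq; rewrite ex !mulrBl fk => /eqP; rewrite subr_eq => /eqP ekq.
  by rewrite ew epi !mulrBl ekq opprB addrA [X in X - _]addrAC subrr.
have Spi : S pi by rewrite epi; apply/SD/SN/SM.
have Sw : S w by rewrite ew; do 2!apply/SD/SN => //.
have [c1 [Sc1 kc1 c1k c1c1]] := idemS Sk kk.
(* On the three summands [c] is [c0], then a complex structure [c1] on the rest of the kernel, then
   the lift [s * c0 * N] of [c0] through [N]. *)
pose c := c0 - c0 * k + c1 + s * c0 * N * w.
have Sc : S c.
  apply: SD; last by apply: SM => //; apply: OO => //; apply: OS.
  by apply: SD => //; apply/SD/SN/SM.
have Nc1 : N * c1 = 0 by rewrite -kc1 mulrA Nk mul0r.
have Nc : N * c = c0 * N.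
  have -> : N * c = c0 * N * (p - p * k + w).
    by rewrite /c !mulrDr !mulrN !mulrA c0N Nc1 addr0 -ep pc0.
  rewrite ew -epi addrA [pi + _]addrC subrK mulrBr -!mulrA Nf Nk.
  by rewrite mulr0 subr0.
have cN : c * N = c0 * N.
  rewrite /c !mulrDl mulNr (mulr_eq kN) (mulr_eq wN) -c1k (mulr_eq kN).
  by rewrite !mulr0 oppr0 !addr0.
have cp : c * p = c0 by rewrite ep mulrA cN -mulrA -ep.
have wk : w * k = 0.
  by rewrite ew epi !mulrBl fk (mulr_eq kk) kk subrr subr0 subrr.
have ck : c * k = c1.
  by rewrite /c !mulrDl mulNr (mulr_eq kk) subrr add0r c1k (mulr_eq wk) mulr0 addr0.
have fc1 : f * c1 = c1 by rewrite -kc1 mulrA fk.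
have c1f : c1 * f = c1 by rewrite -c1k (mulr_eq kf).
have fc0 : f * c0 = c0 by rewrite -pc0 mulrA fp.
have c0f : c0 * f = c0 by rewrite -c0p (mulr_eq pf).
have fpi : f * pi = pi by rewrite epi mulrBr mulrA fp.
have pif : pi * f = pi by rewrite epi mulrBl (mulr_eq kf) pf.
have wf : w * f = w by rewrite ew !mulrBl pif kf ff.
have fc : f * c = c by rewrite /c !mulrDr mulrN !mulrA fc0 fc1 fs.
have cf : c * f = c.
  by rewrite /c !mulrDl mulNr c0f c1f (mulr_eq kf) (mulr_eq wf).
have fE : f = pi + k + w by rewrite ew -(addrA f) -opprD [RHS]addrC subrK.
clearbody c.
(* The defect [e] vanishes on [pi] and [k], so it factors through [w]; its values lie in the kernel
   of [N], which [w] kills. Hence [e * e = 0]. *)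
have [e eE] : exists e, e = c * c + f by exists (c * c + f).
have Se : S e by rewrite eE; apply: SD => //; apply: SM.
have fe : f * e = e by rewrite eE mulrDr mulrA fc ff.
have ef : e * f = e by rewrite eE mulrDl (mulr_eq cf) ff.
have Ne : N * e = 0.
  by rewrite eE mulrDr mulrA Nc -mulrA Nc mulrA c0c0 Nf mulNr pN addNr.
have e_pi : e * pi = 0.
  have cpi : c * pi = c0 - c0 * k by rewrite epi mulrBr mulrA cp.
  have cc0 : c * c0 = - p by rewrite -pc0 mulrA cp c0c0.
  rewrite eE mulrDl fpi -mulrA cpi mulrBr mulrA cc0 mulNr.
  by rewrite epi -opprD addNr.
have e_k : e * k = 0.
  by rewrite eE mulrDl fk -mulrA ck -kc1 mulrA ck c1c1 addNr.
have eew : e * w = e by rewrite -{2}ef fE !mulrDr e_pi e_k !add0r.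
have qe : q * e = e by rewrite eq mulrBl fe -mulrA Ne mulr0 subr0.
have ee : e * e = 0 by rewrite -{1}eew -{2}qe mulrA (mulr_eq wq) mulr0 mul0r.
have eN : e * N = 0 by rewrite -eew (mulr_eq wN) mulr0.
have ec : e * c = c * e by rewrite eE mulrDl mulrDr fc cf mulrA.
have cc : c * c = e - f by rewrite eE addrK.
exists (c + hf * (c * e)); split.
- by apply: SD => //; apply/Shf/SM.
- by rewrite mulrDr fc mulrA hfC -mulrA [f * (c * e)]mulrA fc.
- by rewrite mulrDl cf -!mulrA ef.
- have cce : c * (c * e) = - e by rewrite mulrA cc mulrBl ee fe sub0r.
  have cec : c * e * c = - e by rewrite -mulrA ec.
  have cece : c * e * (c * e) = 0 by rewrite mulrA cec mulNr ee oppr0.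
  rewrite mulrDl !mulrDr [c * (hf * _)]mulrA hfC -!(mulrA hf) cce cec.
  rewrite [c * e * (hf * _)]mulrA hfC -(mulrA hf) cece !mulr0 addr0 cc.
  by rewrite -addrA -mulrDl hf2 mul1r addrAC subrr add0r.
- rewrite mulrDl mulrDr cN Nc [N * (hf * _)]mulrA hfC -!mulrA eN.
  by rewrite [N * (c * e)]mulrA Nc -mulrA Ne !mulr0.
Qed.

End CommutingStructure.

(** * Skew-involutive reversors in a real algebra *)

Section Algebra.

Variables (R : rcfType) (E : nzRingType) (iota : {rmorphism R -> E}).
Hypothesis iotaC : forall x r, x * iota r = iota r * x.

Definition ev (a : E) : {poly R} -> E := horner_morph (iotaC a).

HB.instance Definition _ a := GRing.RMorphism.copy (ev a) (horner_morph (iotaC a)).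

Lemma evC a r : ev a r%:P = iota r. Proof. exact: horner_morphC. Qed.
Lemma evX a : ev a 'X = a. Proof. exact: horner_morphX. Qed.

Lemma ev_comm x a a' p : x * a = a' * x -> x * ev a p = ev a' p * x.
Proof.
move=> xa; elim/poly_ind: p => [|p c IHp]; first by rewrite !rmorph0 mulr0 mul0r.
rewrite !rmorphD !rmorphM /= !evC !evX mulrDr mulrDl iotaC mulrA IHp.
by rewrite -!mulrA xa.
Qed.

(** On a corner where [d] annihilates [a], polynomials in [a] matter only modulo [d]: square roots
    modulo [d] become square roots of elements. *)
Lemma ev_eq d a f p q :
  ev a d * f = 0 -> d %| p - q -> ev a p * f = ev a q * f.
Proof.
move=> df /dvdpP[e epq]; rewrite -(subrK q p) epq rmorphD rmorphM mulrDl.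
by rewrite -mulrA df mulr0 add0r.
Qed.

Let hf := iota 2^-1.
Let hf2 : hf + hf = 1.
Proof. by rewrite -rmorphD -mulr2n -[_ *+ 2]mulr_natr mulVf ?pnatr_eq0 ?rmorph1. Qed.
Let hfC x : x * hf = hf * x.
Proof. exact: iotaC. Qed.

Lemma eq_opp0 (x : E) : x = - x -> x = 0.
Proof. by move=> xN; rewrite -[x]mul1r -hf2 mulrDl {2}xN mulrN subrr. Qed.

Hypothesis algE : forall a : E, exists2 m : {poly R}, m != 0 & ev a m = 0.
Hypothesis regE : forall a : E, exists b, a * b * a = a.
Hypothesis idemE : forall f : E, f * f = f ->
  exists c, [/\ f * c = c, c * f = c & c * c = - f].

Lemma nilpotent_structure_alg m (f N : E) :
    f * f = f -> f * N = N -> N * f = N -> N ^+ m.+1 = 0 ->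
  exists c, [/\ f * c = c, c * f = c, c * c = - f & c * N = N * c].
Proof.
move=> ff fN Nf N0.
have [||||||||||c [_ ? ? ? ?]] // :=
  @nilpotent_structure E hf hf2 hfC (fun=> True) (fun=> True) _ _ _ _ _ _ _ _ _
    _ m f N I ff I fN Nf N0; last by exists c.
- by move=> x _; have [y ?] := regE x; exists y.
- by move=> x _; have [y ?] := regE x; exists y.
- by move=> {ff fN Nf}f _ ff; have [c [? ? ?]] := idemE ff; exists c.
Qed.

(** [(e + k e) / 2] is the idempotent of the part of [e] where [k] acts as 1, so a complex structure
    on it is fixed by [k]. The halves for [k] and [- k] add up to [e]. *)
Lemma half_structure (f k : E) : f * f = f -> k * k = f -> f * k = k ->
  k * f = k -> forall e, e * e = e -> f * e = e -> e * f = e -> k * e = e * k ->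
  exists c, [/\ k * c = c, c * k = c, e * c = c, c * e = c
              & c * c = - (hf * (e + k * e))].
Proof.
move=> ff kk fk kf e ee fe ef ke.
have eke : e * k * e = k * e by rewrite -ke -mulrA ee.
pose g := hf * (e + k * e).
have kg : k * g = g.
  by rewrite /g mulrA hfC -mulrA mulrDr mulrA kk fe addrC.
have gk : g * k = g.
  by rewrite /g -mulrA mulrDl -ke (mulr_eq (esym ke)) mulrA kk fe addrC.
have eg : e * g = g.
  by rewrite /g mulrA hfC -mulrA mulrDr ee mulrA eke.
have ge : g * e = g by rewrite /g -mulrA mulrDl ee (mulr_eq ee).
have gg : g * g = g.
  by rewrite {2}/g mulrA hfC -mulrA mulrDr mulrA gk ge -[g + g]mulr2n -mulr_natl
     mulrA -[2]/(1 + 1) mulrDr mulr1 hf2 mul1r.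
have [c [gc cg cc]] := idemE gg.
exists c; split=> //.
- by rewrite -gc mulrA kg.
- by rewrite -cg (mulr_eq gk).
- by rewrite -gc mulrA eg.
- by rewrite -cg (mulr_eq ge).
Qed.

(** Conjugation by [k] grades the corner of [f]: even elements commute with [k], odd ones
    anticommute. Averaging over this conjugation turns a generalised inverse of a homogeneous
    element into a homogeneous one. *)
Lemma graded_nilpotent_structure m (f k N : E) :
    f * f = f -> k * k = f -> f * k = k -> k * f = k ->
    f * N = N -> N * f = N -> k * N = - (N * k) -> N ^+ m.+1 = 0 ->
  exists c, [/\ f * c = c, c * f = c, c * c = - f, c * N = N * c & k * c = c * k].
Proof.
move=> ff kk fk kf fN Nf kN N0.
pose S x := [/\ f * x = x, x * f = x & k * x = x * k].
pose O x := [/\ f * x = x, x * f = x & k * x = - (x * k)].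
have [||||||||||||c [[_ _ ?] ? ? ? ?]] // :=
  @nilpotent_structure E hf hf2 hfC S O _ _ _ _ _ _ _ _ _
    _ m f N _ ff _ fN Nf N0; last by exists c.
- by move=> x y [? ? kx] [? ? ky]; split; rewrite ?mulrDr ?mulrDl; congr (_ + _).
- by move=> x [? ? kx]; split; rewrite ?mulrN ?mulNr; congr (- _).
- by move=> x y [fx ? kx] [? yf ky]; split;
    rewrite ?mulrA ?fx ?(mulr_eq yf) // kx -!mulrA ky.
- move=> x [fx xf kx]; split; rewrite ?mulrA ?hfC -!mulrA ?fx ?xf ?kx //.
- by move=> x y [fx ? kx] [? yf ky]; split;
    rewrite ?mulrA ?fx ?(mulr_eq yf) // kx -!mulrA ky mulrN.
- by move=> x y [fx ? kx] [? yf ky]; split;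
    rewrite ?mulrA ?fx ?(mulr_eq yf) // kx mulNr -!mulrA ky.
- by move=> x y [fx ? kx] [? yf ky]; split;
    rewrite ?mulrA ?fx ?(mulr_eq yf) // kx mulNr -!mulrA ky mulrN opprK.
- move=> x [fx xf kx]; have [y xyx] := regE x.
  exists (hf * (f * y * f + k * y * k)).
    split.
    + by rewrite mulrA hfC -mulrA mulrDr !mulrA ff fk.
    + by rewrite -mulrA mulrDl (mulr_eq ff) (mulr_eq kf).
    + rewrite mulrA hfC -!mulrA; congr (_ * _).
      rewrite mulrDr mulrDl !mulrA kk kf -(mulrA _ f k) fk.
      by rewrite -(mulrA _ k k) kk addrC.
  rewrite mulrA hfC -!(mulrA hf) mulrDr mulrDl !mulrA xf (mulr_eq fx) xyx.
  have xyxz z : x * (y * (x * z)) = x * z by rewrite !mulrA xyx.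
  rewrite -kx (mulr_eq kx) -!mulrA xyxz mulrA kx (mulr_eq kk) xf.
  by rewrite mulrDr -mulrDl hf2 mul1r.
- move=> x [fx xf kx]; have [y xyx] := regE x.
  exists (hf * (f * y * f - k * y * k)).
    split.
    + by rewrite mulrA hfC -mulrA mulrBr !mulrA ff fk.
    + by rewrite -mulrA mulrBl (mulr_eq ff) (mulr_eq kf).
    + rewrite mulrA hfC -!mulrA -[RHS]mulrN; congr (_ * _).
      rewrite mulrBr mulrBl !mulrA kk kf -(mulrA _ f k) fk.
      by rewrite -(mulrA _ k k) kk opprB.
  have xk : x * k = - (k * x) by rewrite kx opprK.
  rewrite mulrA hfC -!(mulrA hf) mulrBr mulrBl !mulrA xf (mulr_eq fx) xyx.
  have xyxz z : x * (y * (x * z)) = x * z by rewrite !mulrA xyx.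
  rewrite xk (mulr_eq kx) !mulNr mulrN !opprK -!mulrA xyxz mulrA kx.
  by rewrite mulNr opprK (mulr_eq kk) xf mulrDr -mulrDl hf2 mul1r.
- move=> e [fe ef ke] ee.
  (* The structures on the parts of [e] where [k] is 1 and -1 annihilate each other, and their sum
     is even. *)
  have [c [kc ck ec ce cc]] := half_structure ff kk fk kf ee fe ef ke.
  have [||||c' [kc' ck' ec' ce' cc']] := half_structure (k := - k) ff _ _ _ ee fe ef _.
  + by rewrite mulrNN.
  + by rewrite mulrN fk.
  + by rewrite mulNr kf.
  + by rewrite mulrN mulNr ke.
  have {}kc' : k * c' = - c' by rewrite -{2}kc' mulNr opprK.
  have {}ck' : c' * k = - c' by rewrite -{2}ck' mulrN opprK.
  have c'c : c' * c = 0.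
    by apply: eq_opp0; rewrite -{1}kc mulrA ck' mulNr.
  have c_c' : c * c' = 0.
    by apply: eq_opp0; rewrite -{1}ck -mulrA kc' mulrN.
  exists (c + c'); split.
  + split; first by rewrite -ec -ec' -mulrDr mulrA fe.
      by rewrite -ce -ce' -mulrDl -mulrA ef.
    by rewrite mulrDr mulrDl kc kc' ck ck'.
  + by rewrite mulrDr ec ec'.
  + by rewrite mulrDl ce ce'.
  + rewrite mulrDr !mulrDl c'c c_c' addr0 add0r cc cc' -opprD -mulrDr mulNr.
    by rewrite addrACA subrr addr0 mulrDr -mulrDl hf2 mul1r.
- by split=> //; rewrite kf fk.
Qed.

(** * Skew reversors glued from corners *)

Section Reversor.

Variables (u w : E) (sigma : R).
Hypotheses (sigma0 : sigma != 0) (uw : u * w = w * u).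
Hypothesis ww : w * w = ev u ('X ^+ 2 - sigma%:P).

(* [-f] plays the role of [-1] in the corner [f E f]. *)
Definition good f :=
  exists Y, [/\ f * Y = Y, Y * f = Y, Y * Y = - f, Y * u = u * Y & Y * w = - (w * Y)].

(** The factor [t] is 1 for a general reversor; [t = k * k] says that [k] squares to 1 on the corner
    of [f]. *)
Definition admissible h t f :=
  [/\ f * f = f, f * u = u * f, f * w = w * f, f * h = h * f & t * f = f].

Lemma good0 : good 0.
Proof. by exists 0; split; rewrite ?(mul0r, mulr0, oppr0). Qed.

Lemma goodD f g : f * g = 0 -> g * f = 0 -> good f -> good g -> good (f + g).
Proof.
move=> fg gf [Y [fY Yf YY Yu Yw]] [Z [gZ Zg ZZ Zu Zw]].
have YZ : Y * Z = 0 by rewrite -Yf -gZ mulrA (mulr_eq fg) mulr0 mul0r.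
have ZY : Z * Y = 0 by rewrite -Zg -fY mulrA (mulr_eq gf) mulr0 mul0r.
have fZ : f * Z = 0 by rewrite -gZ mulrA fg mul0r.
have gY : g * Y = 0 by rewrite -fY mulrA gf mul0r.
have Zf : Z * f = 0 by rewrite -Zg -mulrA gf mulr0.
have Yg : Y * g = 0 by rewrite -Yf -mulrA fg mulr0.
exists (Y + Z); split; rewrite !(mulrDl, mulrDr).
- by rewrite fY gZ fZ gY addr0 add0r.
- by rewrite Yf Zg Zf Yg addr0 add0r.
- by rewrite YY ZZ YZ ZY addr0 add0r opprD.
- by rewrite Yu Zu.
- by rewrite Yw Zw opprD.
Qed.

(** As [a] commutes with [u], [w] and [h], the idempotents of its primary decomposition, built from
    Bezout coefficients, cut [f] into orthogonal admissible pieces, which [goodD] glues. *)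
Lemma good_primary (h t a : E) :
    a * u = u * a -> a * w = w * a -> a * h = h * a ->
    (forall f, admissible h t f -> f * a = a * f) ->
    (forall r k f, admissible h t f -> ev a (('X - r%:P) ^+ k) * f = 0 ->
       good f) ->
    (forall x y k f, y != 0 -> admissible h t f -> ev a (quadp x y ^+ k) * f = 0 ->
       good f) ->
  forall f, admissible h t f -> good f.
Proof.
move=> au aw ah fa good_lin good_quad f admf.
have [m m0 am0] := algE a.
suff {f admf} P : forall f, admissible h t f -> ev a m * f = 0 -> good f.
  by apply: P => //; rewrite am0 mul0r.
move: m m0 {am0}; apply: real_poly_ind.
- move=> c c0 f _; rewrite evC => cf0; suff -> : f = 0 by apply: good0.
  by rewrite -[f]mul1r -(rmorph1 iota) -(mulVf c0) rmorphM -mulrA cf0 mulr0.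
- by move=> r k f; apply: good_lin.
- by move=> x y k y0 f; apply: good_quad.
move=> m1 m2 /Bezout_eq1_coprimepP[[s1 s2] /= e1] P1 P2 f admf m0.
have [ff fu fw fh tf] := admf; have fa_ := fa f admf.
have fe p : f * ev a p = ev a p * f by apply: ev_comm.
have eu p : ev a p * u = u * ev a p by apply/esym/ev_comm.
have ew p : ev a p * w = w * ev a p by apply/esym/ev_comm.
have eh p : ev a p * h = h * ev a p by apply/esym/ev_comm.
have adm p : m1 * m2 %| p * p - p -> admissible h t (f * ev a p).
  move=> mp; split.
  - rewrite -mulrA [ev a p * _]mulrA -fe -mulrA -rmorphM mulrA ff.
    by rewrite (fe (p * p)) (ev_eq m0 mp) fe.
  - by rewrite -mulrA eu mulrA fu mulrA.
  - by rewrite -mulrA ew mulrA fw mulrA.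
  - by rewrite -mulrA eh mulrA fh mulrA.
  - by rewrite mulrA tf.
have vanish p : m1 * m2 %| p -> ev a p * f = 0.
  by move=> mp; rewrite (@ev_eq (m1 * m2) a f p 0) ?subr0 // rmorph0 mul0r.
(* The factors cross over: the first summand is killed by [ev a m1], the second by [ev a m2]. *)
have -> : f = f * ev a (s2 * m2) + f * ev a (s1 * m1).
  by rewrite -mulrDr -rmorphD addrC e1 rmorph1 mulr1.
have prod0 p q : m1 * m2 %| p * q -> f * ev a p * (f * ev a q) = 0.
  move=> mpq; rewrite mulrA -[f * _ * f]mulrA -fe mulrA ff -mulrA -rmorphM.
  by rewrite fe vanish.
have m12 : m1 * m2 %| s2 * m2 * (s1 * m1).
  by rewrite mulrACA [m2 * _]mulrC dvdp_mulIr.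
apply: goodD; [exact: prod0|by apply: prod0; rewrite [X in _ %| X]mulrC| |].
- apply: P1; last by rewrite fe mulrA -rmorphM vanish // mulrCA dvdp_mulIr.
  apply: adm; rewrite -[X in _ - X]mulr1 -mulrBr -e1 opprD addrCA subrr addr0.
  by rewrite mulrN dvdpNr.
- apply: P2; last by rewrite fe mulrA -rmorphM vanish // mulrCA [m2 * _]mulrC dvdp_mulIr.
  apply: adm; rewrite -[X in _ - X]mulr1 -mulrBr -e1 opprD addNKr.
  by rewrite mulrN dvdpNr [X in _ %| X]mulrC.
Qed.

(** * Reversors that square to 1 on the corner *)

Section Involution.

Variable k : E.
Hypotheses (ku : k * u = u * k) (kw : k * w = - (w * k)).

Lemma good_structure f c : admissible k (k * k) f ->
    f * c = c -> c * f = c -> c * c = - f ->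
    c * k = k * c -> c * u = u * c -> c * w = w * c -> good f.
Proof.
move=> [ff _ _ fk kkf] fc cf cc ck cu cw; exists (k * c); split.
- by rewrite mulrA fk -mulrA fc.
- by rewrite -mulrA cf.
- by rewrite mulrA -(mulrA k c k) ck !mulrA -(mulrA (k * k)) cc mulrN kkf.
- by rewrite -mulrA cu !mulrA ku.
- by rewrite -mulrA cw !mulrA kw mulNr.
Qed.

(** Rescaling [w] by a polynomial in [u] keeps it anticommuting with [k], while [v] adjusts its
    square: the uses below make [z * z] equal to [f], equal to [- f], or nilpotent. *)
Lemma odd_partP v f (z := w * ev u v * f) : admissible k (k * k) f ->
  [/\ f * z = z, z * f = z, k * z = - (z * k), z * u = u * z
    & z * w = w * z] /\ z * z = ev u (('X ^+ 2 - sigma%:P) * v ^+ 2) * f.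
Proof.
move=> [ff fu fw fk kkf].
have fV : f * ev u v = ev u v * f by apply: ev_comm.
have Vu : ev u v * u = u * ev u v by apply/esym/ev_comm.
have Vw : ev u v * w = w * ev u v by apply/esym/ev_comm.
have Vk : ev u v * k = k * ev u v by apply/esym/ev_comm.
have fz : f * z = z by rewrite /z !mulrA fw (mulr_eq fV) !mulrA (mulr_eq ff).
split; first split=> //; rewrite /z.
- by rewrite (mulr_eq ff).
- by rewrite !mulrA kw (mulr_eq fk) mulrA (mulr_eq Vk) mulrA !mulNr.
- by rewrite (mulr_eq fu) mulrA (mulr_eq Vu) !mulrA uw.
- by rewrite (mulr_eq fw) mulrA (mulr_eq Vw) !mulrA.
rewrite -mulrA -/z fz /z !mulrA (mulr_eq Vw) !mulrA ww -!rmorphM -mulrA.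
by rewrite -expr2.
Qed.

Lemma comm_odd f c z p : f * w = w * f -> f * c = c -> c * f = c ->
  c * u = u * c -> c * z = z * c -> w * f = z * (ev u p * f) -> c * w = w * c.
Proof.
move=> fw fc cf cu cz wf; have ce : c * ev u p = ev u p * c by apply: ev_comm.
rewrite -{1}cf -mulrA fw wf mulrA cz -mulrA (mulrA c) ce -mulrA cf -fc.
by rewrite [in RHS]mulrA wf !mulrA.
Qed.

(** On the corner let [z = w / (u + r)]. Then [z^2 = (u - r) / (u + r)] is nilpotent and
    [u = r (1 + z^2) / (1 - z^2)], so the single odd nilpotent [z] encodes both [u] and [w]: a
    complex structure commuting with [z] commutes with both. *)
Lemma good_involution_eq0 r j f : r ^+ 2 = sigma -> admissible k (k * k) f ->
  ev u (('X - r%:P) ^+ j) * f = 0 -> good f.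
Proof.
move=> rs admf; have [ff fu fw fk kkf] := admf.
have fe p : f * ev u p = ev u p * f by apply: ev_comm.
set d := 'X - r%:P => df.
have r0 : r != 0 by apply: contraNneq sigma0 => r0; rewrite -rs r0 expr0n.
have : coprimep (d ^+ j) ('X + r%:P).
  rewrite coprimep_expl // coprimep_sym coprimep_XsubC /root !hornerE.
  by rewrite -mulr2n mulrn_eq0.
case/Bezout_eq1_coprimepP=> -[s v] /= e1.
have dv : d ^+ j %| ('X + r%:P) * v - 1.
  by rewrite -e1 mulrC opprD addrCA subrr addr0 -mulNr dvdp_mulIr.
have [[]] := odd_partP v admf.
set g := _ * v ^+ 2; set z := w * _ * f => fz zf kz zu zw zz.
have eg : g = d * (('X + r%:P) * v ^+ 2) by rewrite /g /d -rs polyC_exp; ring.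
have wf : w * f = z * (ev u ('X + r%:P) * f).
  rewrite /z mulrA -(mulrA _ f) fe !mulrA -(mulrA w) -rmorphM [v * _]mulrC.
  by rewrite -!mulrA ff (ev_eq df dv) rmorph1 mul1r.
clearbody g z.
have zzX i : (z * z) ^+ i * f = ev u (g ^+ i) * f.
  elim: i => [|i IHi]; first by rewrite !expr0 rmorph1.
  by rewrite !exprS -mulrA IHi zz rmorphM -!mulrA [f * (_ * f)]mulrA fe -mulrA ff.
have zz0 : (z * z) ^+ j * f = 0.
  rewrite zzX (@ev_eq (d ^+ j) u f _ 0) ?rmorph0 ?mul0r // subr0 eg exprMn.
  by rewrite dvdp_mulIl.
have kf2 : k * f * (k * f) = f by rewrite mulrA -(mulrA k) fk mulrA -mulrA ff.
have [||||||c [fc cf cc cz ck]] := @graded_nilpotent_structure (j.*2) f (k * f) z ff kf2.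
- by rewrite mulrA fk -mulrA ff.
- by rewrite -mulrA ff.
- exact: fz.
- exact: zf.
- by rewrite -mulrA fz kz -fk mulrA zf.
(* The last factor [z = f * z] supplies the [f] next to which [(z * z) ^+ j] vanishes. *)
- by rewrite exprSr -[X in _ * X = _]fz mulrA -mul2n exprM expr2 zz0 mul0r.
have cn : c * (z * z) = z * z * c by rewrite mulrA cz -mulrA cz mulrA.
pose a := u * f.
have fa : f * a = a by rewrite /a mulrA fu -mulrA ff.
have eB : a - z * z * a = iota r * (f + z * z).
  have -> : a - z * z * a = ev u ('X - g * 'X) * f.
    rewrite rmorphB rmorphM /= evX mulrBl /a zz -!mulrA (mulrA f u) fu.
    by rewrite -(mulrA u) ff.
  have -> : iota r * (f + z * z) = ev u (r%:P * (1 + g)) * f.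
    by rewrite rmorphM rmorphD rmorph1 /= evC -mulrA mulrDl mul1r zz.
  apply: ev_eq df _; case/dvdpP: dv => e ev_.
  (* The difference is [- d ((X + r) v - 1) ((X + r) v + 1)], whose middle factor is a multiple of
     [d ^+ j]. *)
  apply/dvdpP; exists (- (d * e * (('X + r%:P) * v + 1))).
  rewrite mulNr mulrAC -(mulrA d) -ev_ eg /d; ring.
have cB : c * (a - z * z * a) = (a - z * z * a) * c.
  by rewrite eB mulrA iotaC -!(mulrA (iota r)) mulrDl [c * (_ + _)]mulrDr cf fc cn.
(* The commutator is fixed by left multiplication with [z * z], which is nilpotent on the corner. *)
have D0 : c * a - a * c = 0.
  set D := (X in X = 0).
  have DE : D = z * z * D.
    apply/eqP; rewrite -subr_eq0; apply/eqP.
    rewrite -[RHS](subrr ((a - z * z * a) * c)) -{1}cB /D !mulrBr !mulrBl.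
    rewrite (mulrA c (z * z)) cn -(mulrA (z * z)) !opprB addrACA [RHS]addrACA.
    by rewrite [- (a * c) - _]addrC !mulrA.
  have DX i : D = (z * z) ^+ i * D.
    by elim: i => [|i IHi]; rewrite ?expr0 ?mul1r // exprSr -mulrA -DE.
  have fD : f * D = D by rewrite /D mulrBr (mulrA f c) fc (mulrA f a) fa.
  by rewrite (DX j) -fD mulrA zz0 mul0r.
have cu : c * u = u * c.
  by rewrite -{1}cf -mulrA fu -/a (subr0_eq D0) /a -mulrA fc.
apply: (good_structure (c := c) admf) => //.
  by rewrite -{1}cf -mulrA fk -ck -mulrA fc.
exact: comm_odd wf.
Qed.

(** Here [z = w / sqrt (sigma - u^2)] squares to -1 on the corner and exchanges the parts where [k]
    is 1 and -1. A complex structure commuting with [u] on the first part is carried by [z] to the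
    other. *)
Lemma good_involution_lt0 r j f : r ^+ 2 < sigma -> admissible k (k * k) f ->
  ev u (('X - r%:P) ^+ j) * f = 0 -> good f.
Proof.
move=> rs admf; have [ff fu fw fk kkf] := admf.
set d := 'X - r%:P => df.
have fe p : f * ev u p = ev u p * f by apply: ev_comm.
have q0 : 0 < (sigma%:P - 'X ^+ 2).[r] by rewrite !hornerE subr_gt0.
have [v dv] := invsqrt_mod_linear j q0.
have [[]] := odd_partP v admf; set z := w * _ * f => fz zf kz zu zw zz.
have wf : w * f = z * (ev u ((sigma%:P - 'X ^+ 2) * v) * f).
  rewrite /z mulrA -(mulrA _ f) fe !mulrA -(mulrA w) -rmorphM [v * _]mulrC.
  by rewrite -!mulrA -expr2 ff (ev_eq df dv) rmorph1 mul1r.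
have {}zz : z * z = - f.
  rewrite zz -[_ - _]opprB mulNr rmorphN mulNr.
  by rewrite (ev_eq df dv) rmorph1 mul1r.
clearbody z.
pose k1 := k * f.
have fk1 : f * k1 = k1 by rewrite /k1 mulrA fk -mulrA ff.
have k1f : k1 * f = k1 by rewrite /k1 -mulrA ff.
pose f1 := hf * (f + k1).
have kf1 : k * f1 = f1.
  by rewrite /f1 mulrA hfC -mulrA mulrDr mulrA kkf addrC.
have f1k : f1 * k = f1.
  by rewrite /f1 -mulrA mulrDl fk -(mulrA k) fk mulrA kkf addrC.
have ff1 : f * f1 = f1 by rewrite /f1 mulrA hfC -mulrA mulrDr ff fk1.
have f1f : f1 * f = f1 by rewrite /f1 -mulrA mulrDl ff k1f.
have f1f1 : f1 * f1 = f1.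
  rewrite {2}/f1 mulrA hfC -mulrA mulrDr f1f mulrA f1k f1f.
  by rewrite mulrDr -mulrDl hf2 mul1r.
have f1u : f1 * u = u * f1.
  rewrite /f1 -mulrA [RHS]mulrA hfC -[RHS]mulrA; congr (_ * _).
  by rewrite mulrDl mulrDr /k1 -mulrA fu !mulrA ku.
have f1E : f1 = hf * (f + k1) by [].
clearbody f1.
have f1zf1 : f1 * z * f1 = 0.
  by apply: eq_opp0; rewrite -{1}f1k -!mulrA (mulrA k) kz mulNr -mulrA kf1 mulrN.
have zf1z : z * f1 * z = hf * (k1 - f).
  rewrite f1E mulrA hfC -!mulrA; congr (_ * _).
  rewrite mulrDl mulrDr fz zz /k1 -(mulrA k) fz kz mulrN mulrA zz mulNr opprK.
  by rewrite fk addrC.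
have f1e p : f1 * ev u p = ev u p * f1 by apply: ev_comm.
pose N := ev u d * f1.
have NX i : N ^+ i * f1 = ev u (d ^+ i) * f1.
  elim: i => [|i IHi]; first by rewrite !expr0 rmorph1.
  by rewrite !exprS -mulrA IHi rmorphM -!mulrA [f1 * _]mulrA f1e -mulrA f1f1.
have f1N : f1 * N = N by rewrite mulrA f1e -mulrA f1f1.
have Nf1 : N * f1 = N by rewrite -mulrA f1f1.
have N0 : N ^+ j.+1 = 0.
  by rewrite exprSr -[X in _ * X = _]f1N mulrA NX -ff1 mulrA df !mul0r.
have [c1 [fc1 c1f c1c1 c1N]] := nilpotent_structure_alg f1f1 f1N Nf1 N0.
have c1u : c1 * u = u * c1.
  have : c1 * ev u d = ev u d * c1.
    by rewrite -{1}c1f -mulrA f1e c1N -mulrA fc1.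
  rewrite rmorphB /= evX evC mulrBr mulrBl iotaC.
  exact: addIr.
have c1zc1 : c1 * z * c1 = 0.
  rewrite -[X in X * z]c1f -[X in _ * X = _]fc1 mulrA -(mulrA c1 f1).
  by rewrite -(mulrA c1 (f1 * z)) f1zf1 mulr0 mul0r.
have {}fc1' : f * c1 = c1 by rewrite -fc1 mulrA ff1.
have {}c1f' : c1 * f = c1 by rewrite -c1f -mulrA f1f.
have kc1 : k * c1 = c1 by rewrite -fc1 mulrA kf1.
have c1k : c1 * k = c1 by rewrite -c1f -mulrA f1k.
have zk : z * k = - (k * z) by rewrite kz opprK.
(* Since [- z] inverts [z] on the corner, this is [c1] plus its conjugate by [z]. *)
pose c := c1 - z * c1 * z.
have fc : f * c = c by rewrite mulrBr !mulrA fz fc1'.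
have cf : c * f = c by rewrite mulrBl c1f' (mulr_eq zf).
have cu : c * u = u * c.
  rewrite mulrBl mulrBr c1u (mulr_eq zu) !mulrA (mulr_eq c1u) !mulrA.
  by rewrite zu.
have cz : c * z = z * c.
  rewrite mulrBl mulrBr (mulr_eq zz) mulrN (mulr_eq c1f') !mulrA zz !mulNr fc1'.
  by rewrite !opprK addrC.
apply: (good_structure (c := c) admf) => //.
- rewrite mulrBl !mulrBr !mulrA c1zc1 mul0r subr0 c1c1.
  have -> : z * c1 * z * c1 = 0 by rewrite -!mulrA (mulrA c1) c1zc1 mulr0.
  rewrite sub0r.
  rewrite (mulr_eq zz) mulrN (mulr_eq c1f') mulNr (mulr_eq c1c1) mulrN mulNr.
  rewrite mulNr !opprK zf1z f1E -mulrN -mulrDr opprD addrA addrNK.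
  by rewrite mulrDr -mulrDl hf2 mul1r.
- have zczk : z * c1 * z * k = - (z * c1 * z).
    by rewrite (mulr_eq zk) mulrN mulrA (mulr_eq c1k).
  have kzcz : k * (z * c1 * z) = - (z * c1 * z).
    by rewrite !mulrA kz !mulNr (mulr_eq kc1).
  by rewrite mulrBl mulrBr kc1 c1k zczk kzcz.
exact: comm_odd wf.
Qed.

Lemma good_involution f : admissible k (k * k) f -> good f.
Proof.
have evu p : [/\ ev u p * u = u * ev u p, ev u p * w = w * ev u p
                & ev u p * k = k * ev u p].
  by split; apply/esym/ev_comm.
apply: (good_primary (a := u)) => //; first by move=> g [].
  move=> r j {}f admf; have [ff fu fw fk kkf] := admf.
  have fe p : f * ev u p = ev u p * f by apply: ev_comm.
  have [q0|q0|q0] := ltrgtP (r ^+ 2 - sigma) 0; last first.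
  - by apply: good_involution_eq0 => //; apply/eqP; rewrite -subr_eq0 q0.
  - move=> df.
    have q0' : 0 < ('X ^+ 2 - sigma%:P).[r] by rewrite !hornerE.
    have [v dv] := invsqrt_mod_linear j q0'.
    have [[fz zf kz zu zw]] := odd_partP v admf.
    move: (w * ev u v * f) fz zf kz zu zw => z fz zf kz zu zw.
    rewrite (ev_eq df dv) rmorph1 mul1r => zz.
    exists (k * z); split.
    + by rewrite mulrA fk -mulrA fz.
    + by rewrite -mulrA zf.
    + have zk : z * k = - (k * z) by rewrite kz opprK.
      by rewrite -mulrA (mulrA z) zk mulNr mulrN -mulrA zz mulrA kkf.
    + by rewrite -mulrA zu !mulrA ku.
    + by rewrite -mulrA zw !mulrA kw mulNr.
  - by apply: good_involution_lt0 => //; rewrite -subr_lt0.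
move=> x y j {}f y0 admf df; have [ff fu fw fk kkf] := admf.
have fe p : f * ev u p = ev u p * f by apply: ev_comm.
(* An inverse square root of -1 modulo the power of [quadp x y] yields a complex structure that is a
   polynomial in [u]. *)
have /(invsqrt_mod_quadratic x j y0)[v dv] : (-1) +i* (0 * y) != 0.
  by rewrite eq_complex /= negb_and oppr_eq0 oner_eq0.
have [cu cw ck] := evu v.
have vvf : ev u v * ev u v * f = - f.
  have := ev_eq df dv; rewrite mul0r addr0 polyCN mulNr rmorphN mul1r rmorph1.
  by rewrite expr2 rmorphM mulNr mul1r => /eqP; rewrite eqr_oppLR => /eqP.
apply: (good_structure (c := ev u v * f) admf).
- by rewrite mulrA fe -mulrA ff.
- by rewrite -mulrA ff.
- by rewrite mulrA -(mulrA _ f) fe -!mulrA ff mulrA vvf.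
- by rewrite -mulrA fk mulrA ck mulrA.
- by rewrite -mulrA fu mulrA cu mulrA.
- by rewrite -mulrA fw mulrA cw mulrA.
Qed.
End Involution.

(** Decompose along [h * h]. At negative or non-real eigenvalues [h / sqrt (- h^2)] already serves;
    at positive ones [h / sqrt (h^2)] reduces to the involutive case; at 0 the corner is zero, as
    [h] has a left inverse. *)
Lemma good_reversor h h' f : h' * h = 1 -> h * u = u * h -> h * w = - (w * h) ->
  admissible h 1 f -> good f.
Proof.
move=> h'h hu hw; pose a := h * h.
have au : a * u = u * a by rewrite /a -mulrA hu !mulrA hu.
have aw : a * w = w * a by rewrite /a -mulrA hw mulrN !mulrA hw mulNr opprK.
have ah : a * h = h * a by rewrite /a mulrA.
have fa g : admissible h 1 g -> g * a = a * g.
  by move=> [_ _ _ fh _]; rewrite /a mulrA fh -mulrA fh mulrA.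
have root_part g v (z := h * ev a v * g) : admissible h 1 g ->
    [/\ g * z = z, z * g = z, z * u = u * z & z * w = - (w * z)] /\
    z * z = ev a ('X * v ^+ 2) * g.
  move=> admg; have gV : g * ev a v = ev a v * g by apply/ev_comm/fa.
  have Vu : ev a v * u = u * ev a v by apply/esym/ev_comm.
  have Vw : ev a v * w = w * ev a v by apply/esym/ev_comm.
  have Vh : ev a v * h = h * ev a v by apply/esym/ev_comm.
  have [gg gu gw gh _] := admg.
  have gz : g * z = z by rewrite /z !mulrA gh (mulr_eq gV) mulrA (mulr_eq gg).
  split; first split=> //; rewrite /z.
  - by rewrite (mulr_eq gg).
  - by rewrite (mulr_eq gu) mulrA (mulr_eq Vu) !mulrA hu.
  - by rewrite (mulr_eq gw) mulrA (mulr_eq Vw) !mulrA hw !mulNr.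
  rewrite -mulrA -/z gz /z !mulrA (mulr_eq Vh) !mulrA -/a.
  by rewrite -{1}(evX a) -!rmorphM -mulrA -expr2.
have good_neg d g v : admissible h 1 g -> ev a d * g = 0 ->
    d %| - 'X * v ^+ 2 - 1 -> good g.
  move=> admg dg dv; have [[]] := root_part g v admg.
  set z := h * _ * g => gz zg zu zw zz; exists z; split=> //.
  rewrite zz -['X]opprK mulNr rmorphN mulNr.
  by rewrite (ev_eq dg dv) rmorph1 mul1r.
apply: (good_primary (a := a)) => //.
  move=> r j {}f admf df; have [r0|r0|r0] := ltrgtP r 0.
  - have [|v] := @invsqrt_mod_linear _ r (- 'X) j; first by rewrite !hornerE oppr_gt0.
    exact: good_neg.
  - have [|v dv] := @invsqrt_mod_linear _ r 'X j; first by rewrite !hornerE.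
    have [[]] := root_part f v admf; set k := h * _ * f => fk kf ku kw.
    rewrite (ev_eq df dv) rmorph1 mul1r => kk.
    have [ff fu fw _ _] := admf.
    by apply: (good_involution ku kw); split; rewrite ?kk // fk kf.
  - suff -> : f = 0 by apply: good0.
    move: df; rewrite r0 subr0 rmorphXn /= evX.
    elim: j => [|j IHj]; first by rewrite expr0 mul1r.
    move=> af; apply: IHj; move: af; rewrite exprS /a.
    move/(congr1 (fun x => h' * (h' * x))).
    by rewrite !mulr0 -!mulrA (mulrA h' h) h'h mul1r mulrA h'h mul1r.
move=> x y j {}f y0 admf df.
(* These coefficients write [- 'X] as [- x - ('X - x)]. *)
have /(invsqrt_mod_quadratic x j y0)[v] : (- x) +i* (-1 * y) != 0.
  by rewrite eq_complex /= negb_and mulN1r !oppr_eq0 y0 orbT.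
rewrite !polyCN polyC1 mulN1r opprB addKr; exact: good_neg admf df.
Qed.

End Reversor.

Theorem skew_involutive_reversor (g g' h h' : E) (e : R) :
    g * g' = 1 -> g' * g = 1 -> h' * h = 1 -> e * e = 1 ->
    h * g = iota e * g' * h ->
  exists Y, Y * Y = -1 /\ Y * g = iota e * g' * Y.
Proof.
move=> gg' g'g h'h ee hg.
have ie2 : iota e * iota e = 1 by rewrite -rmorphM ee rmorph1.
have [b bE] : exists b, b = iota e * g' by exists (iota e * g').
have gb : g * b = iota e by rewrite bE mulrA iotaC -mulrA gg' mulr1.
have bg : b * g = iota e by rewrite bE -mulrA g'g mulr1.
move: hg; rewrite -bE => hg.
(* Multiply [b * h = h * g] by [g] on the left and [b] on the right, then cancel the central
   [g * b], whose square is 1. *)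
have hb : h * b = g * h.
  have t : g * b * (h * b) = g * h * (g * b).
    by rewrite -!mulrA (mulrA b h) -hg !mulrA.
  rewrite -[LHS]mul1r -[RHS]mul1r -ie2 -!(mulrA (iota e)); congr (_ * _).
  by rewrite -[in LHS]gb t gb iotaC.
pose u := g + b; pose w := g - b.
have uw : u * w = w * u.
  rewrite mulrDl !mulrBr [RHS]mulrBl !mulrDr gb bg.
  by rewrite addrA subrK opprD addrA addrK.
have ww : w * w = ev u ('X ^+ 2 - (4 * e)%:P).
  rewrite rmorphB rmorphXn /= evX evC expr2 mulr_natl rmorphMn /=.
  rewrite mulrBl !mulrBr mulrDl !mulrDr gb bg opprB addrACA.
  rewrite [iota e + b * b]addrC [in RHS]addrACA -mulr2n -opprD -mulr2n.
  by rewrite (mulrnDr _ 2 2); move: (iota e *+ 2) => t; rewrite opprD addrA addrK.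
have hu : h * u = u * h by rewrite mulrDr mulrDl hb hg addrC.
have hw : h * w = - (w * h) by rewrite mulrBr mulrBl hb hg opprB.
have e0 : 4 * e != 0.
  rewrite mulf_neq0 ?pnatr_eq0 //; apply/eqP => e0.
  by move/eqP: ee; rewrite e0 mul0r eq_sym oner_eq0.
have [|Y [_ _ YY Yu Yw]] := good_reversor e0 uw ww h'h hu hw (f := 1).
- by split; rewrite ?mulr1 ?mul1r.
exists Y; split=> //.
have g2 : g = hf * (u + w) by rewrite /u /w addrACA addrN addr0 mulrDr -mulrDl hf2 mul1r.
have b2 : b = hf * (u - w).
  by rewrite /u /w opprB [X in hf * X]addrC addrA subrK mulrDr -mulrDl hf2 mul1r.
by rewrite g2 b2 mulrA hfC -!mulrA mulrDr mulrBl Yu Yw.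
Qed.

End Algebra.

(** * Quaternionic matrices *)

Section QuaternionMatrices.

Variable R : rcfType.
Local Notation H := (quat R).
Local Notation C := R[i].
Local Notation conjmx := (map_mx (Num.conj : C -> C)).

Lemma quat_inv (q : H) : q != 0 -> exists x, x * q = 1.
Proof.
case: q => z w q0; pose N := z * z^*%R + w * w^*%R.
have N0 : N != 0.
  apply: contraNneq q0 => /eqP; rewrite paddr_eq0 ?mul_conjC_ge0 //.
  by rewrite !mul_conjC_eq0 => /andP[/eqP -> /eqP ->].
exists (Quat (z^*%R / N) (- (w / N))); congr Quat => /=; last first.
  by rewrite mulNr mulrAC [z^* * w]mulrC mulrAC subrr.
by rewrite mulNr opprK ![_ / N * _]mulrAC -mulrDl [z^* * z]mulrC mulfV.
Qed.

Definition qreal (r : R) : H := Quat r%:C 0.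

Lemma qreal_is_additive : additive qreal.
Proof. by move=> r s; rewrite /qreal rmorphB; congr Quat; rewrite subr0. Qed.
Lemma qreal_is_multiplicative : multiplicative qreal.
Proof.
split=> // r s; congr Quat; rewrite /= ?mul0r ?mulr0 ?subr0 ?addr0 ?rmorphM //.
Qed.
HB.instance Definition _ := GRing.isAdditive.Build R H qreal qreal_is_additive.
HB.instance Definition _ :=
  GRing.isMultiplicative.Build R H qreal qreal_is_multiplicative.

Lemma conjc_toC (r : R) : (r%:C)^*%R = r%:C.
Proof. by apply/eqP; rewrite -CrealE; apply/complex_realP; exists r. Qed.

Lemma qrealC (q : H) r : q * qreal r = qreal r * q.
Proof.
case: q => z w; congr Quat; rewrite /= ?conjc_toC ?rmorph0.
  by rewrite mulr0 mul0r !subr0 mulrC.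
by rewrite mulr0 mul0r add0r addr0 mulrC.
Qed.

Section Dimension.

Variable n : nat.
Local Notation E := 'M[H]_n.+1.

Definition realmx (r : R) : E := (qreal r)%:M.

HB.instance Definition _ := GRing.RMorphism.copy realmx (@scalar_mx H n.+1 \o qreal).

Lemma realmxC (A : E) r : A * realmx r = realmx r * A.
Proof.
apply/matrixP=> i j; rewrite -[_ * A]/(realmx r *m A) mul_scalar_mx !mxE.
rewrite (bigD1 j) //= big1 ?addr0 => [|k kj]; first by rewrite !mxE eqxx qrealC.
by rewrite !mxE (negPf kj) mulr0.
Qed.

Lemma complexmxD (A B : E) : complexmx (A + B) = complexmx A + complexmx B.
Proof.
by rewrite /complexmx add_block_mx /cpart1 /cpart2 !map_mxD /= opprD.
Qed.

Lemma complexmx0 : complexmx (0 : E) = 0.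
Proof. by apply: (addrI (complexmx 0)); rewrite -complexmxD !addr0. Qed.

Lemma complexmx_real r : complexmx (realmx r) = r%:C%:M.
Proof.
rewrite [RHS]scalar_mx_block /complexmx.
have -> : cpart1 (realmx r) = r%:C%:M.
  by apply/matrixP=> i j; rewrite !mxE; case: (i == j); rewrite ?raddf0.
have -> : cpart2 (realmx r) = 0.
  by apply/matrixP=> i j; rewrite !mxE; case: (i == j); rewrite ?raddf0.
by rewrite map_mx0 oppr0 map_scalar_mx /= conjc_toC.
Qed.

Lemma complexmx_ev (A : E) p :
  complexmx (ev realmxC A p) = horner_mx (complexmx A) (map_poly (real_complex R) p).
Proof.
elim/poly_ind: p => [|p c IHp].
  by rewrite !rmorph0 complexmx0.
rewrite !rmorphD !rmorphM /= map_polyC map_polyX horner_mx_C horner_mx_X.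
by rewrite complexmxD complexmxM IHp evX evC complexmx_real.
Qed.

(** The characteristic polynomial of the complex form times its conjugate is real, and
    Cayley-Hamilton applies to it. *)
Lemma matrix_algebraic (A : E) : exists2 m : {poly R}, m != 0 & ev realmxC A m = 0.
Proof.
pose P := char_poly (complexmx A); pose Q := P * map_poly Num.conj P.
have Qreal : map_poly (real_complex R) (map_poly (@complex.Re R) Q) = Q.
  have conjPK : map_poly Num.conj (map_poly Num.conj P) = P.
    by rewrite -map_poly_comp map_poly_id // => x _; rewrite /= conjCK.
  apply/polyP=> i; rewrite coef_map coef_map_id0 //=; apply/RRe_real.
  by rewrite CrealE -coef_map /Q rmorphM /= conjPK mulrC.
have P0 : P != 0 by rewrite monic_neq0 ?char_poly_monic.
exists (map_poly (@complex.Re R) Q).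
  have : Q != 0 by rewrite mulf_neq0 ?map_poly_eq0.
  by apply: contraNneq => Q0; rewrite -Qreal Q0 rmorph0.
apply: complexmx_inj; rewrite complexmx_ev Qreal rmorphM /= Cayley_Hamilton mul0r.
by rewrite complexmx0.
Qed.

Let T : 'M[C]_(n.+1 + n.+1) := block_mx 0 1%:M (- 1%:M) 0.

(* The quaternionic conjugation of complex matrices: its fixed points are the
   image of [complexmx]. *)
Definition qconj (X : 'M[C]_(n.+1 + n.+1)) := T *m conjmx X *m - T.

Let TT : - T *m T = 1%:M.
Proof.
rewrite /T opp_block_mx mulmx_block !(mulmx0, mul0mx, mulmx1, mul1mx, mulNmx, mulmxN).
by rewrite !(oppr0, addr0, add0r, opprK) -scalar_mx_block.
Qed.

Lemma qconjM X Y : qconj (X *m Y) = qconj X *m qconj Y.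
Proof.
by rewrite /qconj map_mxM !mulmxA -[_ *m - T *m T]mulmxA TT mulmx1.
Qed.

Lemma qconj_block (X1 X2 X3 X4 : 'M[C]_n.+1) :
  qconj (block_mx X1 X2 X3 X4)
  = block_mx (conjmx X4) (- conjmx X3) (- conjmx X2) (conjmx X1).
Proof.
rewrite /qconj /T opp_block_mx map_block_mx !mulmx_block.
rewrite !(mulmx0, mul0mx, mulmx1, mul1mx, mulNmx, mulmxN).
by rewrite !(oppr0, addr0, add0r, opprK).
Qed.

Lemma qconj_complexmx (A : E) : qconj (complexmx A) = complexmx A.
Proof. by rewrite /complexmx qconj_block map_mxN !Defs.conjmxK opprK. Qed.

Lemma qconj_average X : exists A : E, complexmx A = 2^-1 *: (X + qconj X).
Proof.
rewrite -[X]submxK; set X1 := ulsubmx X; set X2 := ursubmx X.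
set X3 := dlsubmx X; set X4 := drsubmx X.
pose Y1 := 2^-1 *: (X1 + conjmx X4); pose Y2 := 2^-1 *: (X2 - conjmx X3).
exists (\matrix_(i, j) Quat (Y1 i j) (Y2 i j)).
have h : Num.conj (2^-1 : C) = 2^-1 by rewrite fmorphV rmorph_nat.
rewrite qconj_block add_block_mx scale_block_mx /complexmx.
have -> : cpart1 (\matrix_(i, j) Quat (Y1 i j) (Y2 i j)) = Y1.
  by apply/matrixP=> i j; rewrite !mxE.
have -> : cpart2 (\matrix_(i, j) Quat (Y1 i j) (Y2 i j)) = Y2.
  by apply/matrixP=> i j; rewrite !mxE.
rewrite /Y1 /Y2 !map_mxZ /= h map_mxB map_mxD /= !Defs.conjmxK -scalerN opprB.
by rewrite [conjmx X1 + _]addrC.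
Qed.

(** The equation [A X A = A] is preserved by [qconj] and by averaging, so a complex solution
    averaged with its conjugate is a quaternionic one. *)
Lemma matrix_regular (A : E) : exists B, A * B * A = A.
Proof.
pose X := pinvmx (complexmx A).
have AXA : complexmx A *m X *m complexmx A = complexmx A by apply: mulmxKpV.
have [B eB] := qconj_average X; exists B.
apply: complexmx_inj; rewrite !complexmxM eB -scalemxAr -scalemxAl.
rewrite mulmxDr mulmxDl AXA -{2 3}[complexmx A]qconj_complexmx -!qconjM AXA.
rewrite qconj_complexmx -mulr2n -[complexmx A *+ 2]scaler_nat scalerA mulVf ?scale1r //.
by rewrite pnatr_eq0.
Qed.

(** [qconj] conjugates determinants and fixes the complex form of [A]. *)
Lemma qdet_real (A : E) : qdet A \is Num.real.
Proof.
have e1 : \det T * \det (- T) = 1 by rewrite mulrC -det_mulmx TT det1.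
rewrite CrealE; apply/eqP/esym; rewrite /qdet -{1}(qconj_complexmx A).
by rewrite /qconj !det_mulmx mulrAC e1 mul1r det_map_mx.
Qed.

(** Induction on the rank of the complex form. A nonzero entry of [f] gives a column [v] and a
    normalised row [w] with [w *m v = 1]; then [v *m w] is an idempotent below [f] with complex
    structure [v qI w], and removing it lowers the rank. *)
Lemma idempotent_structure (f : E) : f * f = f ->
  exists c, [/\ f * c = c, c * f = c & c * c = - f].
Proof.
have [r] := ubnP (\rank (complexmx f)); elim: r f => // r IHr f rk ff.
have [->|f0] := eqVneq f 0.
  by exists 0; split; rewrite ?mul0r ?oppr0.
have /existsP[i /existsP[j fij]] : [exists i, exists j, f i j != 0].
  apply: contraNT f0 => /existsPn f0; apply/eqP/matrixP=> i j; rewrite mxE.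
  by have /existsPn/(_ j)/negPn/eqP := f0 i.
have [x xf] := quat_inv fij.
pose v : 'cV[H]_n.+1 := col j f.
pose w : 'rV[H]_n.+1 := x *: row i f.
have fE a b : \sum_k f a k * f k b = f a b by rewrite -[in RHS]ff mxE.
have fv : f *m v = v.
  by apply/matrixP=> a b; rewrite !mxE -fE; apply: eq_bigr => k _; rewrite mxE.
have wf : w *m f = w.
  rewrite -scalemxAl; congr (_ *: _); apply/matrixP=> a b; rewrite !mxE -fE.
  by apply: eq_bigr => k _; rewrite mxE.
have wv : w *m v = 1%:M.
  rewrite -scalemxAl; apply/matrixP=> a b; rewrite !mxE !ord1 -xf -fE.
  by congr (_ * _); apply: eq_bigr => k _; rewrite !mxE.
pose f1 : E := v *m w; pose c1 : E := v *m (qI R)%:M *m w.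
have ff1 : f * f1 = f1 by rewrite -[f * f1]/(f *m f1) mulmxA fv.
have f1f : f1 * f = f1 by rewrite -[f1 * f]/(f1 *m f) -mulmxA wf.
have f1f1 : f1 * f1 = f1.
  by rewrite -[f1 * f1]/(f1 *m f1) /f1 mulmxA -(mulmxA v) wv mulmx1.
have f1c1 : f1 * c1 = c1.
  by rewrite -[f1 * c1]/(f1 *m c1) /f1 /c1 !mulmxA -(mulmxA v w v) wv mulmx1.
have c1f1 : c1 * f1 = c1.
  by rewrite -[c1 * f1]/(c1 *m f1) /f1 /c1 !mulmxA -(mulmxA _ w v) wv mulmx1.
have c1c1 : c1 * c1 = - f1.
  rewrite -[c1 * c1]/(c1 *m c1) /f1 /c1 !mulmxA -(mulmxA _ w v) wv mulmx1.
  by rewrite -(mulmxA v) -scalar_mxM qI_sqr raddfN /= mulmxN mulmx1 mulNmx.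
clearbody c1.
pose f2 := f - f1.
have f2f2 : f2 * f2 = f2.
  by rewrite mulrBl !mulrBr ff ff1 f1f f1f1 subrr subr0.
have f1f2 : f1 * f2 = 0 by rewrite mulrBr f1f f1f1 subrr.
have f2f1 : f2 * f1 = 0 by rewrite mulrBl ff1 f1f1 subrr.
have f2f : f2 * f = f2 by rewrite mulrBl ff f1f.
have ff2 : f * f2 = f2 by rewrite mulrBr ff ff1.
have v0 : v != 0.
  apply: contraNneq fij => v0; move/(congr1 (fun u : 'cV_n.+1 => u i 0)): v0.
  by rewrite !mxE => ->.
have lt_rk : (\rank (complexmx f2) < \rank (complexmx f))%N.
  have sub : (complexmx f2 <= complexmx f)%MS by rewrite -f2f complexmxM submxMl.
  (* Equal ranks would make the complex form of [f] a left multiple of that of [f2], so that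
     [f1 = f * f1] would vanish. *)
  rewrite ltn_neqAle (mxrank_leqif_sup sub) (mxrankS sub) andbT.
  apply/negP => /submxP[D eD].
  have : complexmx f1 = complexmx 0.
    by rewrite -ff1 complexmxM eD -mulmxA -complexmxM -[f2 *m f1]/(f2 * f1)
       f2f1 complexmx0 mulmx0.
  move/complexmx_inj => f10.
  by move: v0; rewrite -[v]mulmx1 -wv mulmxA -/f1 f10 mul0mx eqxx.
have [c2 [f2c2 c2f2 c2c2]] := IHr f2 (leq_trans lt_rk rk) f2f2.
have c12 : c1 * c2 = 0 by rewrite -c1f1 -f2c2 mulrA (mulr_eq f1f2) mulr0 mul0r.
have c21 : c2 * c1 = 0 by rewrite -c2f2 -f1c1 mulrA (mulr_eq f2f1) mulr0 mul0r.
exists (c1 + c2); split.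
- by rewrite mulrDr -f1c1 -f2c2 !mulrA ff1 ff2.
- by rewrite mulrDl -c1f1 -c2f2 -!mulrA f1f f2f.
- by rewrite mulrDl !mulrDr c12 c21 addr0 add0r c1c1 c2c2 -opprD addrC subrK.
Qed.

(** The determinant is the square of the real number [qdet Z], hence nonnegative, and its own square
    is [qdet (-1) = 1]. *)
Lemma qdet_skew_involution (Y : E) : Y * Y = -1 -> qdet Y = 1.
Proof.
move=> YY; pose s := realmx (Num.sqrt 2^-1); pose Z := s * (1 + Y).
have sq : (1 + Y) * (1 + Y) = realmx 2 * Y.
  rewrite mulrDl !mulrDr !mul1r mulr1 YY [Y + -1]addrC addrACA subrr add0r.
  by rewrite -mulr2n -[Y *+ 2]mulr_natl rmorph_nat.
have ZZ : Z * Z = Y.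
  rewrite /Z -mulrA [(1 + Y) * _]mulrA realmxC !mulrA -rmorphM -expr2.
  rewrite sqr_sqrtr ?invr_ge0 ?ler0n // -mulrA sq mulrA -rmorphM mulVf.
    by rewrite rmorph1 mul1r.
  by rewrite pnatr_eq0.
have dY : qdet Y = qdet Z ^+ 2 by rewrite -{1}ZZ expr2 -qdetM.
have dY2 : qdet Y ^+ 2 = 1.
  by rewrite expr2 -qdetM -[Y *m Y]/(Y * Y) YY qdetN qdet1.
have dY0 : 0 <= qdet Y by rewrite dY -realEsqr qdet_real.
move/eqP: dY2; rewrite sqrf_eq1 => /orP[/eqP //|/eqP eN].
by move: dY0; rewrite eN oppr_ge0 ler10.
Qed.

End Dimension.

(** Reversibility lifts to [K G = e G^-1 K] with a sign [e]. The resulting [Y] has determinant 1,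
    and [Y^2 = -1] is trivial in the quotient. *)
Lemma psl_reversible_strongly n (g : PSL R n.+1) :
  reversible g -> strongly_reversible g.
Proof.
have [G ->] := pslpi_surj g; case=> h; have [K ->] := pslpi_surj h => {g h} rev.
have GG' : slval G *m slval G^-1%g = 1%:M by rewrite -[LHS]/(slval (G * G^-1)%g) mulgV.
have G'G : slval G^-1%g *m slval G = 1%:M by rewrite -[LHS]/(slval (G^-1 * G)%g) mulVg.
have K'K : slval K^-1%g *m slval K = 1%:M by rewrite -[LHS]/(slval (K^-1 * K)%g) mulVg.
have reversalP (A : SL R n.+1) :
    (pslpi A * pslpi G * (pslpi A)^-1 = (pslpi G)^-1)%g <->
    (pslpi (A * G) = pslpi (G^-1 * A))%g.
  have GV : (pslpi G)^-1%g = pslpi G^-1%g by exact: pslpiV.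
  rewrite !pslpi_morph -GV; split=> [<-|->]; first by rewrite mulgVK.
  by rewrite mulgK.
have [e ee KG] : exists2 e : R, e * e = 1 &
    slval K *m slval G = realmx n e * slval G^-1%g * slval K.
  case/reversalP/pslpi_eq: rev => rev.
    by exists 1; rewrite ?mulr1 // rmorph1 mul1r; apply: esym.
  exists (-1); rewrite ?mulrNN ?mulr1 // rmorphN1 mulN1r mulNr.
  by rewrite -[RHS]/(- (slval (G^-1 * K)%g)) rev opprK.
have [Y [YY YG]] := skew_involutive_reversor (@matrix_algebraic n)
  (@matrix_regular n) (@idempotent_structure n) GG' G'G K'K ee KG.
pose y := MkSL (introT eqP (qdet_skew_involution YY)).
exists (pslpi y); split.
  rewrite /involution expg2 -pslpi_morph; apply/pslpi_eq; right.
  by rewrite -[slval (y * y)%g]/(Y * Y) YY opprK.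
apply/reversalP/pslpi_eq.
have -> : slval (y * G)%g = realmx n e * slval (G^-1 * y)%g.
  by rewrite -[LHS]/(Y * slval G) YG -mulrA.
have [->|->] : e = 1 \/ e = -1.
  by move/eqP: ee; rewrite -expr2 sqrf_eq1 => /orP[] /eqP; [left|right].
  by left; rewrite rmorph1 mul1r.
by right; rewrite rmorphN1 mulN1r opprK.
Qed.

End QuaternionMatrices.

Theorem theorem1p1 (R : realType) (n : nat) (hn : (0 < n)%N) (g : PSL R n) :
  reversible g <-> strongly_reversible g.
Proof.
case: n hn g => // n _ g; split; first exact: psl_reversible_strongly.
by case=> h [_ hg]; exists h.
Qed.
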